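(* Let $\beta$ be a real constant, let $\rho_\pm>0$ and $u_\pm$ be given constants, and let $\gamma\in(1,2)$. Consider the inhomogeneous Euler system of one-dimensional compressible fluid flow $$\rho_t+(\rho u)_x=0,\qquad u_t+\Big(\frac{u^2}{2}+\frac{\gamma-1}{4}\rho^{\gamma-1}\Big)_x=\beta,$$ and the pressureless Euler system with the same source term $$\rho_t+(\rho u)_x=0,\qquad u_t+\Big(\frac{u^2}{2}\Big)_x=\beta,$$ both with Riemann initial data $(\rho,u)(0,x)=(\rho_-,u_-)$ for $x<0$ and $(\rho_+,u_+)$ for $x>0$. If $u_+<u_-$, then, as $\gamma\to1$, the Riemann solution containing two shocks of the first system with the Riemann initial data $(\rho_\pm,u_\pm)$ (constructed as in the context) converges to a delta shock solution of the second (pressureless) system with the same Riemann initial data $(\rho_\pm,u_\pm)$.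
   Context: Two-shock Riemann solution of the first system. When $u_+<u_-$, for all $\gamma>1$ sufficiently close to $1$ the Riemann solution consists of two shocks. With the change of variable $v=u-\beta t$, the intermediate state $(\rho_{*\gamma},v_{*\gamma})$ satisfies $\rho_{*\gamma}>\max\{\rho_-,\rho_+\}$ and $$v_{*\gamma}=u_--\sqrt{\frac{\frac{\gamma-1}{2}(\rho_{*\gamma}^{\gamma-1}-\rho_-^{\gamma-1})}{(\rho_{*\gamma}+\rho_-)(\rho_{*\gamma}-\rho_-)}}\,(\rho_{*\gamma}-\rho_-),\qquad u_+=v_{*\gamma}+\sqrt{\frac{\frac{\gamma-1}{2}(\rho_+^{\gamma-1}-\rho_{*\gamma}^{\gamma-1})}{(\rho_++\rho_{*\gamma})(\rho_+-\rho_{*\gamma})}}\,(\rho_+-\rho_{*\gamma}).$$ The speeds of the 1-shock and the 2-shock are $$\sigma_1^\gamma(t)=u_-+\beta t-\rho_{*\gamma}\sqrt{\frac{\frac{\gamma-1}{2}(\rho_{*\gamma}^{\gamma-1}-\rho_-^{\gamma-1})}{(\rho_{*\gamma}+\rho_-)(\rho_{*\gamma}-\rho_-)}},\qquad \sigma_2^\gamma(t)=v_{*\gamma}+\beta t+\rho_+\sqrt{\frac{\frac{\gamma-1}{2}(\rho_+^{\gamma-1}-\rho_{*\gamma}^{\gamma-1})}{(\rho_++\rho_{*\gamma})(\rho_+-\rho_{*\gamma})}}.$$ The shocks start from the origin and move with these speeds; from left to right the solution $(\rho,u)$ takes the values $(\rho_-,u_-+\beta t)$, $(\rho_{*\gamma},v_{*\gamma}+\beta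 t)$ (between the two shocks), and $(\rho_+,u_++\beta t)$. Delta shock solution of the pressureless system for $u_+<u_-$: $$(\rho,u)(t,x)=\begin{cases}(\rho_-,u_-+\beta t),&x<x(t),\\(w(t)\delta(x-x(t)),u_\delta(t)),&x=x(t),\\(\rho_+,u_++\beta t),&x>x(t),\end{cases}$$ where $\delta$ is the Dirac delta and the location $x(t)$, weight $w(t)$ and propagation speed $u_\delta(t)$ of the delta shock are $$x(t)=\tfrac12(u_-+u_+)t+\tfrac12\beta t^2,\quad w(t)=\tfrac12(\rho_-+\rho_+)(u_--u_+)t,\quad u_\delta(t)=\tfrac12(u_-+u_+)+\beta t.$$ They satisfy, with $v=u-\beta t$, $x(0)=w(0)=0$ and $[\,\cdot\,]$ denoting right value minus left value, the generalized Rankine–Hugoniot conditions $x'(t)=u_\delta(t)$, $w'(t)=u_\delta(t)[\rho]-[\rho(v+\beta t)]$, $u_\delta(t)[v]=[\tfrac12(v+\beta t)^2]$, and the generalized entropy condition $u_++\beta t<u_\delta(t)<u_-+\beta t$. *)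

(* Defs.v *)
From Stdlib Require Import Reals.
From Coquelicot Require Import Coquelicot.
Local Open Scope R_scope.

(** Functions of time and space are written [f : R -> R -> R], with [f t x];
    only times [0 <= t] matter. *)

(** * Test functions and integrals *)

Definition dt (phi : R -> R -> R) (t x : R) : R := Derive (fun s => phi s x) t.
Definition dx (phi : R -> R -> R) (t x : R) : R := Derive (phi t) x.

(** [D i j] is the partial derivative of order [i] in [t] and [j] in [x]. *)
Definition smooth2 (phi : R -> R -> R) : Prop :=
  exists D : nat -> nat -> R -> R -> R,
    (forall t x, D 0%nat 0%nat t x = phi t x) /\
    forall (i j : nat) (t x : R),
      continuity_2d_pt (D i j) t x /\
      is_derive (fun s => D i j s x) t (D (S i) j t x) /\
      is_derive (D i j t) x (D i (S j) t x).

(** Smooth functions with compact support in the whole plane; since they are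
    integrated over [0 <= t] only, they play the role of test functions in
    [[0, +oo) x R], which need not vanish at [t = 0]. *)
Definition test_function (phi : R -> R -> R) : Prop :=
  smooth2 phi /\
  exists M : R, forall t x, phi t x <> 0 -> Rabs t <= M /\ Rabs x <= M.

Definition is_int_line (f : R -> R) (l : R) : Prop :=
  is_RInt_gen f (Rbar_locally m_infty) (Rbar_locally p_infty) l.

Definition is_int_time (f : R -> R) (l : R) : Prop :=
  is_RInt_gen f (at_point 0) (Rbar_locally p_infty) l.

(** The (convergent) iterated integral over [0 <= t], [x] in [R] is [l]. *)
Definition is_int_half_plane (f : R -> R -> R) (l : R) : Prop :=
  exists g : R -> R,
    (forall t, 0 <= t -> is_int_line (f t) (g t)) /\ is_int_time g l.

(** * Riemann data and piecewise functions *)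

Record riemann_data := RiemannData
  { rho_l : R; u_l : R; rho_r : R; u_r : R }.

Definition riemann_step (l r : R) (x : R) : R := if Rlt_dec x 0 then l else r.

(** [l] for [x < a], [r] for [b < x], [m] for [a <= x <= b] (when [a <= b]). *)
Definition three_states (a b l m r : R) (x : R) : R :=
  if Rlt_dec x a then l else if Rlt_dec b x then r else m.

(** * Weak solutions *)

(** [q_t + f_x = s] with [q(0,.) = q0], tested against [phi]. *)
Definition weak_balance (q f : R -> R -> R) (s : R) (q0 : R -> R) : Prop :=
  forall phi, test_function phi ->
    exists a b : R,
      is_int_half_plane
        (fun t x => q t x * dt phi t x + f t x * dx phi t x + s * phi t x) a /\
      is_int_line (fun x => q0 x * phi 0 x) b /\
      a + b = 0.

(** The same for [q + w(t) delta(x - X(t))] and [f + m(t) delta(x - X(t))]. *)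
Definition weak_balance_delta (X : R -> R) (q : R -> R -> R) (w : R -> R)
    (f : R -> R -> R) (m : R -> R) (s : R) (q0 : R -> R) : Prop :=
  forall phi, test_function phi ->
    exists a c b : R,
      is_int_half_plane
        (fun t x => q t x * dt phi t x + f t x * dx phi t x + s * phi t x) a /\
      is_int_time
        (fun t => w t * dt phi t (X t) + m t * dx phi t (X t)) c /\
      is_int_line (fun x => q0 x * phi 0 x) b /\
      a + c + b = 0.

(** Weak solution of
      rho_t + (rho u)_x = 0,
      u_t + (u^2/2 + (gamma-1)/4 rho^(gamma-1))_x = beta
    with Riemann initial data [D]. *)
Definition euler_weak_solution (D : riemann_data) (beta gamma : R)
    (rho u : R -> R -> R) : Prop :=
  weak_balance rho (fun t x => rho t x * u t x) 0
    (riemann_step (rho_l D) (rho_r D)) /\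
  weak_balance u
    (fun t x => (u t x) ^ 2 / 2 + (gamma - 1) / 4 * Rpower (rho t x) (gamma - 1))
    beta (riemann_step (u_l D) (u_r D)).

(** * The two-shock Riemann solution *)

Definition shock_coef (gamma a b : R) : R :=
  sqrt ((gamma - 1) / 2 * (Rpower a (gamma - 1) - Rpower b (gamma - 1))
        / ((a + b) * (a - b))).

(** [(rs, vs)] is the intermediate state in the variables [(rho, v)],
    [v = u - beta t]. *)
Definition intermediate_state (D : riemann_data) (gamma rs vs : R) : Prop :=
  Rmax (rho_l D) (rho_r D) < rs /\
  vs = u_l D - shock_coef gamma rs (rho_l D) * (rs - rho_l D) /\
  u_r D = vs + shock_coef gamma (rho_r D) rs * (rho_r D - rs).

Definition shock_speed1 (D : riemann_data) (beta gamma rs t : R) : R :=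
  u_l D + beta * t - rs * shock_coef gamma rs (rho_l D).

Definition shock_speed2 (D : riemann_data) (beta gamma rs vs t : R) : R :=
  vs + beta * t + rho_r D * shock_coef gamma (rho_r D) rs.

Definition shock_pos1 (D : riemann_data) (beta gamma rs t : R) : R :=
  RInt (shock_speed1 D beta gamma rs) 0 t.

Definition shock_pos2 (D : riemann_data) (beta gamma rs vs t : R) : R :=
  RInt (shock_speed2 D beta gamma rs vs) 0 t.

Definition two_shock_rho (D : riemann_data) (beta gamma rs vs t x : R) : R :=
  three_states (shock_pos1 D beta gamma rs t) (shock_pos2 D beta gamma rs vs t)
    (rho_l D) rs (rho_r D) x.

Definition two_shock_u (D : riemann_data) (beta gamma rs vs t x : R) : R :=
  three_states (shock_pos1 D beta gamma rs t) (shock_pos2 D beta gamma rs vs t)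
    (u_l D + beta * t) (vs + beta * t) (u_r D + beta * t) x.

(** * Delta shock solutions of the pressureless system *)

(** Absolutely continuous part of the density: it is set to [0] on the curve,
    where the density is the measure [w(t) delta(x - X(t))]. *)
Definition delta_rho (D : riemann_data) (X : R -> R) (t x : R) : R :=
  three_states (X t) (X t) (rho_l D) 0 (rho_r D) x.

Definition delta_u (D : riemann_data) (beta : R) (X ud : R -> R) (t x : R) : R :=
  three_states (X t) (X t) (u_l D + beta * t) (ud t) (u_r D + beta * t) x.

(** Delta shock with location [X], weight [w] and speed [ud], for
      rho_t + (rho u)_x = 0,  u_t + (u^2/2)_x = beta
    with Riemann initial data [D]: generalized Rankine-Hugoniot conditions,
    generalized entropy condition, and both equations in the sense of
    distributions, the singular part of [rho u] being [w ud delta]. *)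
Definition delta_shock_solution (D : riemann_data) (beta : R)
    (X w ud : R -> R) : Prop :=
  X 0 = 0 /\ w 0 = 0 /\
  (forall t, 0 <= t ->
    is_derive X t (ud t) /\
    is_derive w t
      (ud t * (rho_r D - rho_l D)
       - (rho_r D * (u_r D + beta * t) - rho_l D * (u_l D + beta * t))) /\
    ud t * (u_r D - u_l D)
      = (u_r D + beta * t) ^ 2 / 2 - (u_l D + beta * t) ^ 2 / 2 /\
    u_r D + beta * t < ud t < u_l D + beta * t) /\
  weak_balance_delta X
    (delta_rho D X) w
    (fun t x => delta_rho D X t x * delta_u D beta X ud t x)
    (fun t => w t * ud t)
    0 (riemann_step (rho_l D) (rho_r D)) /\
  weak_balance (delta_u D beta X ud)
    (fun t x => (delta_u D beta X ud t x) ^ 2 / 2)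
    beta (riemann_step (u_l D) (u_r D)).

Definition delta_pos (D : riemann_data) (beta t : R) : R :=
  / 2 * (u_l D + u_r D) * t + / 2 * beta * t ^ 2.

Definition delta_weight (D : riemann_data) (t : R) : R :=
  / 2 * (rho_l D + rho_r D) * (u_l D - u_r D) * t.

Definition delta_speed (D : riemann_data) (beta t : R) : R :=
  / 2 * (u_l D + u_r D) + beta * t.

(** * Convergence as [gamma] decreases to [1] *)

(** [f gamma] tends to [f0 + w(t) delta(x - X(t))] in the sense of
    distributions. *)
Definition converges_in_distributions (f : R -> R -> R -> R)
    (f0 : R -> R -> R) (X w : R -> R) : Prop :=
  forall phi, test_function phi ->
    exists (I : R -> R) (a c : R),
      at_right 1 (fun gamma =>
        is_int_half_plane (fun t x => f gamma t x * phi t x) (I gamma)) /\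
      is_int_half_plane (fun t x => f0 t x * phi t x) a /\
      is_int_time (fun t => w t * phi t (X t)) c /\
      filterlim I (at_right 1) (locally (a + c)).

(** Convergence of the two-shock solutions with intermediate states
    [(rs gamma, vs gamma)] to the delta shock [(X, w, ud)].  Convergence of [u]
    in distributions does not see the value [ud] on the curve [x = X t]: this
    value is the limit of the intermediate velocity and of both shock speeds,
    and it occurs in the singular part of the limit of [rho u]. *)
Definition converges_to_delta_shock (D : riemann_data) (beta : R)
    (rs vs : R -> R) (X w ud : R -> R) : Prop :=
  let rho gamma := two_shock_rho D beta gamma (rs gamma) (vs gamma) in
  let u gamma := two_shock_u D beta gamma (rs gamma) (vs gamma) in
  converges_in_distributions rho (delta_rho D X) X w /\
  converges_in_distributions u (delta_u D beta X ud) X (fun _ => 0) /\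
  converges_in_distributions (fun gamma t x => rho gamma t x * u gamma t x)
    (fun t x => delta_rho D X t x * delta_u D beta X ud t x)
    X (fun t => w t * ud t) /\
  (forall t, 0 <= t ->
    filterlim (fun gamma => vs gamma + beta * t) (at_right 1) (locally (ud t)) /\
    filterlim (fun gamma => shock_speed1 D beta gamma (rs gamma) t)
      (at_right 1) (locally (ud t)) /\
    filterlim (fun gamma => shock_speed2 D beta gamma (rs gamma) (vs gamma) t)
      (at_right 1) (locally (ud t))).

(* Main.v *)
Require Import Defs.
From Stdlib Require Import Reals Lra ClassicalEpsilon Ranalysis5.
From Coquelicot Require Import Coquelicot.
Local Open Scope R_scope.

(** Put [J = u_l - u_r > 0] and [d = gamma - 1].  The velocity jump across a
    shock joining the densities [a < r] is
    [k_a(r) = sqrt (d/2 (r^d - a^d) (r - a) / (r + a))], which increases from [0]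
    to infinity, so the intermediate density is the unique root of
    [k_l(r) + k_r(r) = J] as soon as the left side is below [J] at
    [max (rho_l, rho_r)].  Since [k_a(r)^2 <= d/2 (1 + r)], the root tends to
    infinity as [d] tends to [0]; then both jumps tend to [J/2], both shock
    speeds tend to the same limit, and the mass [r (s2 - s1) t] between the shocks
    tends to [(rho_l + rho_r) (J/2) t].

    Both weak formulations come from one computation.  In a region bounded by
    curves [a(t) < b(t)] where the state [q] satisfies [q' = s], the tested
    equation integrates in [x] to the time derivative of
    [q(t) * int_a^b phi(t, x) dx] plus boundary terms; these cancel, or are
    compensated by the Dirac mass, by the Rankine-Hugoniot conditions. *)

(** * Test functions and compactly supported integrals *)

(** Only the product of height and width is controlled. Replacing a test function on the strip by
    its value on the delta curve costs that bounded product times the distance to the curve, hence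
    tends to zero. The source term accelerates both shocks and the delta shock by the same [beta].
    The strip therefore has width exactly [(s2 - s1) t], and each convergence in distributions
    reduces to four scalar limits in [gamma]. The two velocity jumps have the same limit [J/2]
    because both squares are close to [d/2 r^d], which does not depend on the outer density. This is
    why the delta shock moves at the mean of the outer velocities, whatever the densities are. *)

(** All partial derivatives of a test function with one common support bound, [i] counting
    derivatives in time and [j] in space. Vanishing includes [|t| = K] and [|x| = K], so boundary
    terms at [K] and [- K] are zero. *)
Definition compact_jet (K : R) (P : nat -> nat -> R -> R -> R) : Prop :=
  0 < K /\
  (forall i j t x,
    continuity_2d_pt (P i j) t x /\
    is_derive (fun s => P i j s x) t (P (S i) j t x) /\
    is_derive (P i j t) x (P i (S j) t x)) /\
  (forall i j t x, K <= Rabs t \/ K <= Rabs x -> P i j t x = 0).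

Lemma locally_Rabs_gt (M y : R) : M < Rabs y -> locally y (fun z => M < Rabs z).
Proof.
  intros H. assert (He : 0 < Rabs y - M) by lra.
  exists (mkposreal _ He). intros z Hz.
  change (Rabs (z - y) < Rabs y - M) in Hz.
  assert (Rabs y <= Rabs (z - y) + Rabs z); [|lra].
  replace y with (- (z - y) + z) at 1 by ring.
  rewrite <- (Rabs_Ropp (z - y)). apply Rabs_triang.
Qed.

Lemma is_derive_locally_zero (f : R -> R) (y l : R) :
  locally y (fun z => f z = 0) -> is_derive f y l -> l = 0.
Proof.
  intros H Hf. rewrite <- (is_derive_unique _ _ _ Hf).
  apply is_derive_unique. apply (is_derive_ext_loc (fun _ => 0)).
  - apply (filter_imp (F := locally y)) with (2 := H). intros z Hz. now symmetry.
  - apply is_derive_Reals, derivable_pt_lim_const.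
Qed.

Lemma test_function_jet (phi : R -> R -> R) :
  test_function phi ->
  exists K P, compact_jet K P /\
    forall t x, phi t x = P O O t x /\ dt phi t x = P 1%nat O t x /\
      dx phi t x = P O 1%nat t x.
Proof.
  intros [[P [HP0 HP]] [M HM]].
  assert (Hz : forall i j t x, M < Rabs t \/ M < Rabs x -> P i j t x = 0).
  { assert (H0 : forall t x, M < Rabs t \/ M < Rabs x -> P O O t x = 0).
    { intros t x H. rewrite HP0.
      destruct (Req_dec (phi t x) 0) as [E|E]; [exact E|].
      destruct (HM t x E). lra. }
    assert (Hj : forall j t x, M < Rabs t \/ M < Rabs x -> P O j t x = 0).
    { induction j as [|j IH]; [exact H0|]. intros t x H.
      apply (is_derive_locally_zero (P O j t) x); [|apply HP].
      destruct H as [H|H].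
      - apply filter_forall. intros z. apply IH. now left.
      - apply filter_imp with (2 := locally_Rabs_gt _ _ H). intros z Hz. apply IH. now right. }
    induction i as [|i IH]; [exact Hj|]. intros j t x H.
    apply (is_derive_locally_zero (fun s => P i j s x) t); [|apply HP].
    destruct H as [H|H].
    - apply filter_imp with (2 := locally_Rabs_gt _ _ H). intros z Hz. apply IH. now left.
    - apply filter_forall. intros z. apply IH. now right. }
  (* The given [M] may be negative, and [Hz] holds on the open set beyond [M], where zero passes to
     derivatives. Adding 1 to [|M|] gives a positive radius and a closed condition. *)
  exists (Rabs M + 1), P. split; [split; [|split]|].
  - pose proof (Rabs_pos M). lra.
  - exact HP.
  - intros i j t x H. apply Hz. pose proof (Rle_abs M). destruct H; [left|right]; lra.
  - intros t x. split; [now rewrite HP0|]. split.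
    + unfold dt. apply is_derive_unique. apply (is_derive_ext (fun s => P O O s x)); [|apply HP].
      intros s. apply HP0.
    + unfold dx. apply is_derive_unique. apply (is_derive_ext (P O O t)); [|apply HP].
      intros s. apply HP0.
Qed.

Lemma continuity_2d_pt_curve (f : R -> R -> R) (a : R -> R) (t : R) :
  continuity_2d_pt f t (a t) -> continuous a t -> continuous (fun s => f s (a s)) t.
Proof.
  intros Hf Ha. apply continuity_2d_pt_filterlim in Hf.
  apply (continuous_comp_2 (fun s : R => s) a f t); [apply continuous_id|exact Ha|].
  exact Hf.
Qed.

Section JetFacts.

Context {K : R} {P : nat -> nat -> R -> R -> R} (HP : compact_jet K P).

Lemma jet_continuity_2d i j t x : continuity_2d_pt (P i j) t x.
Proof. apply (proj1 (proj2 HP)). Qed.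

Lemma jet_is_derive_t i j t x : is_derive (fun s => P i j s x) t (P (S i) j t x).
Proof. apply (proj1 (proj2 HP)). Qed.

Lemma jet_is_derive_x i j t x : is_derive (P i j t) x (P i (S j) t x).
Proof. apply (proj1 (proj2 HP)). Qed.

Lemma jet_continuous_x i j t x : continuous (P i j t) x.
Proof. apply (ex_derive_continuous (P i j t)). eexists. apply jet_is_derive_x. Qed.

Lemma jet_ex_RInt i j t a b : ex_RInt (P i j t) a b.
Proof.
  apply (ex_RInt_continuous (V := R_CompleteNormedModule)).
  intros. apply jet_continuous_x.
Qed.

Lemma jet_continuous_curve i j (a : R -> R) t :
  continuous a t -> continuous (fun s => P i j s (a s)) t.
Proof. apply continuity_2d_pt_curve, jet_continuity_2d. Qed.

Lemma jet_is_derive_RInt i j (a b : R -> R) (da db t : R) :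
  is_derive a t da -> is_derive b t db ->
  is_derive (fun s => RInt (P i j s) (a s) (b s)) t
    (RInt (P (S i) j t) (a t) (b t) + P i j t (b t) * db - P i j t (a t) * da).
Proof.
  intros Ha Hb.
  assert (HD : forall s x, Derive (fun u => P i j u x) s = P (S i) j s x).
  { intros s x. apply is_derive_unique, jet_is_derive_t. }
  assert (HC : forall s x,
    continuity_2d_pt (fun u v => Derive (fun z => P i j z v) u) s x).
  { intros s x. apply (continuity_2d_pt_ext (P (S i) j)); [|apply jet_continuity_2d].
    intros. now rewrite HD. }
  replace (RInt (P (S i) j t) (a t) (b t) + P i j t (b t) * db - P i j t (a t) * da)
    with (RInt (fun x => Derive (fun u => P i j u x) t) (a t) (b t) +
      - P i j t (a t) * da + P i j t (b t) * db).
  - apply is_derive_RInt_param_bound_comp; trivial.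
    + apply filter_forall. intros s. apply jet_ex_RInt.
    + exists posreal_one. apply filter_forall. intros s. apply jet_ex_RInt.
    + exists posreal_one. apply filter_forall. intros s. apply jet_ex_RInt.
    + exists posreal_one. apply filter_forall. intros s x _. eexists. apply jet_is_derive_t.
    + exists posreal_one. intros. apply HC.
    + exists posreal_one. intros. apply HC.
    + apply continuity_pt_filterlim, jet_continuous_x.
    + apply continuity_pt_filterlim, jet_continuous_x.
  - rewrite (RInt_ext _ (P (S i) j t)); [ring|]. intros x _. apply HD.
Qed.

Lemma jet_continuous_RInt i j (a b : R -> R) t :
  ex_derive a t -> ex_derive b t ->
  continuous (fun s => RInt (P i j s) (a s) (b s)) t.
Proof.
  intros [da Ha] [db Hb].
  apply (ex_derive_continuous (fun s => RInt (P i j s) (a s) (b s))). eexists.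
  apply jet_is_derive_RInt; eassumption.
Qed.

Lemma jet_RInt_x i j t a b : RInt (P i (S j) t) a b = P i j t b - P i j t a.
Proof.
  apply is_RInt_unique. apply (is_RInt_derive (P i j t)).
  - intros. apply jet_is_derive_x.
  - intros. apply jet_continuous_x.
Qed.

(* Leibniz's rule for [phi(t, a(t))], the integral of [phi_x(t, .)] over
   [(-K, a(t))], replaces the two-dimensional chain rule. *)
Lemma jet_is_derive_curve (a : R -> R) (da t : R) :
  is_derive a t da ->
  is_derive (fun s => P O O s (a s)) t (P 1%nat O t (a t) + P O 1%nat t (a t) * da).
Proof.
  intros Ha.
  assert (HK : forall i j s, P i j s (- K) = 0).
  { intros. apply HP. right. rewrite Rabs_Ropp, Rabs_pos_eq; [lra|]. apply Rlt_le, HP. }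
  apply (is_derive_ext (fun s => RInt (P O 1%nat s) (- K) (a s))).
  - intros s. rewrite jet_RInt_x, HK. apply Rminus_0_r.
  - replace (P 1%nat O t (a t) + P O 1%nat t (a t) * da)
      with (RInt (P 1%nat 1%nat t) (- K) (a t) + P O 1%nat t (a t) * da
            - P O 1%nat t (- K) * 0).
    + apply (jet_is_derive_RInt O 1%nat (fun _ => - K) a 0 da t); trivial.
      apply is_derive_Reals, derivable_pt_lim_const.
    + rewrite jet_RInt_x, HK. ring.
Qed.

End JetFacts.

(** For compactly supported integrands the proper integrals are eventually constant, so an improper
    integral requires no limit argument. *)
Lemma is_RInt_gen_eventually (f : R -> R) Fa Fb (l : R) :
  filter_prod Fa Fb (fun ab => is_RInt f (fst ab) (snd ab) l) ->
  is_RInt_gen f Fa Fb l.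
Proof.
  intros [Q S HQ HS H] A HA. exists Q S; trivial.
  intros x y Hx Hy. exists l. split; [now apply H|]. now apply locally_singleton.
Qed.

Lemma is_RInt_zero (f : R -> R) (a b : R) :
  (forall x, Rmin a b < x < Rmax a b -> f x = 0) -> is_RInt f a b 0.
Proof.
  intros H. apply (is_RInt_ext (fun _ => 0)).
  - intros x Hx. now rewrite H.
  - pose proof (is_RInt_const (V := R_NormedModule) a b 0) as H0.
    unfold scal in H0; simpl in H0. unfold mult in H0; simpl in H0.
    now rewrite Rmult_0_r in H0.
Qed.

Lemma is_int_time_compact (f : R -> R) (K l : R) :
  (forall t, K <= t -> f t = 0) -> is_RInt f 0 K l -> is_int_time f l.
Proof.
  intros Hz Hf. unfold is_int_time. apply is_RInt_gen_eventually.
  exists (fun x => x = 0) (fun y => K < y); [reflexivity|now exists K|].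
  intros x y -> Hy. simpl. rewrite <- (Rplus_0_r l).
  apply (is_RInt_Chasles f 0 K y l 0 Hf), is_RInt_zero.
  intros z. rewrite Rmin_left by lra. intros Hz'. apply Hz. lra.
Qed.

Lemma is_int_time_unique (f : R -> R) (l l' : R) :
  is_int_time f l -> is_int_time f l' -> l = l'.
Proof.
  intros H H'.
  rewrite <- (is_RInt_gen_unique f l H). now apply (is_RInt_gen_unique f l').
Qed.

(** Only the endpoint 0 contributes, as [h] vanishes at [K]. This boundary term is what brings the
    initial data into the weak formulation. *)
Lemma is_int_time_derive (h dh : R -> R) (K : R) :
  0 < K -> (forall t, is_derive h t (dh t)) -> (forall t, continuous dh t) ->
  (forall t, K <= t -> h t = 0 /\ dh t = 0) -> is_int_time dh (- h 0).
Proof.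
  intros HK Hd Hc Hz. apply (is_int_time_compact _ K); [intros; now apply Hz|].
  replace (- h 0) with (minus (h K) (h 0)).
  - apply (is_RInt_derive h dh); intros; auto.
  - unfold minus, plus, opp; simpl. destruct (Hz K) as [-> _]; [lra|ring].
Qed.

(** [F] is prescribed only off the two breakpoints, a null set, so values on the discontinuity
    curves are free. Only the outer states must vanish far away; the middle one is integrated over a
    bounded interval. *)
Lemma is_int_line_three_states (a b K : R) (fl fm fr F : R -> R) :
  a <= b ->
  (forall x, continuous fl x) -> (forall x, continuous fm x) ->
  (forall x, continuous fr x) ->
  (forall x, K <= Rabs x -> fl x = 0) -> (forall x, K <= Rabs x -> fr x = 0) ->
  (forall x, x <> a -> x <> b -> F x = three_states a b (fl x) (fm x) (fr x) x) ->
  is_int_line F (RInt fl (- K) a + RInt fm a b + RInt fr b K).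
Proof.
  intros Hab Cl Cm Cr Zl Zr HF. unfold is_int_line. apply is_RInt_gen_eventually.
  exists (fun y => y < Rmin a (- Rabs K)) (fun y => Rmax b (Rabs K) < y);
    [now exists (Rmin a (- Rabs K))|now exists (Rmax b (Rabs K))|].
  intros A B HA HB. simpl.
  assert (HA1 := Rlt_le_trans _ _ _ HA (Rmin_l _ _)).
  assert (HA2 := Rlt_le_trans _ _ _ HA (Rmin_r _ _)).
  assert (HB1 := Rle_lt_trans _ _ _ (Rmax_l _ _) HB).
  assert (HB2 := Rle_lt_trans _ _ _ (Rmax_r _ _) HB).
  assert (HK := Rle_abs K).
  assert (Ex : forall f : R -> R, (forall x, continuous f x) ->
    forall y z, is_RInt f y z (RInt f y z)).
  { intros f Hf y z. apply (RInt_correct (V := R_CompleteNormedModule)).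
    apply (ex_RInt_continuous (V := R_CompleteNormedModule)). auto. }
  apply (is_RInt_Chasles F A b B).
  - apply (is_RInt_Chasles F A a b).
    + apply (is_RInt_ext fl).
      { intros x. rewrite Rmin_left, Rmax_right by lra. intros Hx.
        rewrite HF by (apply Rlt_not_eq + apply Rgt_not_eq; lra).
        unfold three_states. destruct (Rlt_dec x a); lra. }
      (* The integrals are oriented: [a] may lie on either side of [- K], and likewise [b] and [K]
         below. *)
      rewrite <- (Rplus_0_l (RInt fl _ _)).
      apply (is_RInt_Chasles fl A (- K) a).
      * apply is_RInt_zero. intros x. rewrite Rmin_left, Rmax_right by lra.
        intros Hx. apply Zl. rewrite <- Rabs_Ropp.
        apply Rle_trans with (- x); [lra|apply Rle_abs].
      * apply Ex, Cl.
    + apply (is_RInt_ext fm); [|apply Ex, Cm].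
      intros x. rewrite Rmin_left, Rmax_right by lra. intros Hx.
      rewrite HF by (apply Rlt_not_eq + apply Rgt_not_eq; lra).
      unfold three_states. destruct (Rlt_dec x a); [lra|].
      destruct (Rlt_dec b x); lra.
  - apply (is_RInt_ext fr).
    { intros x. rewrite Rmin_left, Rmax_right by lra. intros Hx.
      rewrite HF by (apply Rlt_not_eq + apply Rgt_not_eq; lra).
      unfold three_states. destruct (Rlt_dec x a); [lra|].
      destruct (Rlt_dec b x); lra. }
    rewrite <- (Rplus_0_r (RInt fr _ _)).
    apply (is_RInt_Chasles fr b K B); [apply Ex, Cr|].
    apply is_RInt_zero. intros x. rewrite Rmin_left, Rmax_right by lra.
    intros Hx. apply Zr. apply Rle_trans with x; [lra|apply Rle_abs].
Qed.

(** * Weak balance laws for three states *)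

Lemma continuous_Rplus (f g : R -> R) (x : R) :
  continuous f x -> continuous g x -> continuous (fun y => f y + g y) x.
Proof. apply (continuous_plus (V := R_NormedModule) f g). Qed.

Lemma continuous_Rminus (f g : R -> R) (x : R) :
  continuous f x -> continuous g x -> continuous (fun y => f y - g y) x.
Proof. apply (continuous_minus (V := R_NormedModule) f g). Qed.

Lemma continuous_Rmult (f g : R -> R) (x : R) :
  continuous f x -> continuous g x -> continuous (fun y => f y * g y) x.
Proof. apply (continuous_mult (K := R_AbsRing) f g). Qed.

Lemma is_derive_Rplus (f g : R -> R) (x df dg : R) :
  is_derive f x df -> is_derive g x dg -> is_derive (fun y => f y + g y) x (df + dg).
Proof. apply (is_derive_plus (V := R_NormedModule) f g). Qed.

Lemma is_derive_Rmult (f g : R -> R) (x df dg : R) :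
  is_derive f x df -> is_derive g x dg ->
  is_derive (fun y => f y * g y) x (df * g x + f x * dg).
Proof.
  intros Hf Hg. apply (is_derive_mult (K := R_AbsRing) f g x df dg Hf Hg).
  intros; apply Rmult_comm.
Qed.

Lemma is_derive_continuous (f : R -> R) (x l : R) : is_derive f x l -> continuous f x.
Proof. intros H. apply (ex_derive_continuous f). now exists l. Qed.

Lemma RInt_linear3 (f g h : R -> R) (p q r a b : R) :
  ex_RInt f a b -> ex_RInt g a b -> ex_RInt h a b ->
  RInt (fun x => p * f x + q * g x + r * h x) a b =
    p * RInt f a b + q * RInt g a b + r * RInt h a b.
Proof.
  intros Hf Hg Hh. apply is_RInt_unique.
  assert (S : forall k c, ex_RInt k a b -> is_RInt (fun x => c * k x) a b (c * RInt k a b)).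
  { intros k c H. apply (is_RInt_scal (V := R_NormedModule)).
    now apply (RInt_correct (V := R_CompleteNormedModule)). }
  apply (is_RInt_plus (V := R_NormedModule)); [|now apply S].
  apply (is_RInt_plus (V := R_NormedModule)); now apply S.
Qed.

Section JetRegion.

Context {K : R} {P : nat -> nat -> R -> R -> R} (HP : compact_jet K P).

Lemma jet_zero_pos i j t : P i j t K = 0.
Proof. apply HP. right. rewrite Rabs_pos_eq; [lra|]. apply Rlt_le, HP. Qed.

Lemma jet_zero_neg i j t : P i j t (- K) = 0.
Proof. apply HP. right. rewrite Rabs_Ropp, Rabs_pos_eq; [lra|]. apply Rlt_le, HP. Qed.

Lemma jet_zero_late i j t x : K <= t -> P i j t x = 0.
Proof. intros H. apply HP. left. apply Rle_trans with t; [exact H|apply Rle_abs]. Qed.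

Lemma jet_RInt_late i j t a b : K <= t -> RInt (P i j t) a b = 0.
Proof.
  intros H. apply is_RInt_unique, is_RInt_zero. intros. now apply jet_zero_late.
Qed.

Definition region_mass (q a b : R -> R) (t : R) : R :=
  q t * RInt (P O O t) (a t) (b t).

Definition region_rate (s : R) (q a da b db : R -> R) (t : R) : R :=
  s * RInt (P O O t) (a t) (b t) +
  q t * (RInt (P 1%nat O t) (a t) (b t) + P O O t (b t) * db t - P O O t (a t) * da t).

Lemma region_mass_is_derive s (q a da b db : R -> R) t :
  is_derive q t s -> is_derive a t (da t) -> is_derive b t (db t) ->
  is_derive (region_mass q a b) t (region_rate s q a da b db t).
Proof.
  intros Hq Ha Hb.
  apply (is_derive_Rmult q (fun u => RInt (P O O u) (a u) (b u))); [exact Hq|].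
  now apply (jet_is_derive_RInt HP).
Qed.

Lemma region_rate_continuous s (q a da b db : R -> R) t :
  is_derive q t s -> is_derive a t (da t) -> is_derive b t (db t) ->
  continuous da t -> continuous db t ->
  continuous (region_rate s q a da b db) t.
Proof.
  intros Hq Ha Hb Ca Cb.
  assert (CI : forall i j, continuous (fun u => RInt (P i j u) (a u) (b u)) t).
  { intros i j. apply (jet_continuous_RInt HP); eexists; eassumption. }
  assert (Cq := is_derive_continuous _ _ _ Hq).
  assert (Ca' := is_derive_continuous _ _ _ Ha).
  assert (Cb' := is_derive_continuous _ _ _ Hb).
  unfold region_rate.
  apply continuous_Rplus; [apply continuous_Rmult; [apply continuous_const|apply CI]|].
  apply continuous_Rmult; [exact Cq|].
  apply continuous_Rminus; [apply continuous_Rplus; [apply CI|]|];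
    (apply continuous_Rmult; [|assumption]); now apply (jet_continuous_curve HP).
Qed.

(** The term in [phi_x] integrates to boundary values. Adding and subtracting the transport terms of
    the moving ends completes the time derivative of the region mass. What remains at each end is
    the flux relative to that end, [f - q a'] or [f - q b'], the quantity balanced by the
    Rankine-Hugoniot conditions. *)
Lemma RInt_region s (q f a da b db : R -> R) t :
  RInt (fun x => q t * P 1%nat O t x + f t * P O 1%nat t x + s * P O O t x) (a t) (b t) =
  region_rate s q a da b db t + (f t - q t * db t) * P O O t (b t)
    - (f t - q t * da t) * P O O t (a t) :> R.
Proof.
  rewrite RInt_linear3 by apply (jet_ex_RInt HP).
  rewrite (jet_RInt_x HP). unfold region_rate. ring.
Qed.

End JetRegion.

(** The initial data are the three-state profile with both curves at the origin, so the initial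
    integral is covered by the same formula. *)
Lemma riemann_step_three_states l r x : riemann_step l r x = three_states 0 0 l r r x.
Proof.
  unfold riemann_step, three_states.
  destruct (Rlt_dec x 0); [|destruct (Rlt_dec 0 x)]; reflexivity.
Qed.

(* The hypothesis on [dw] is the generalized Rankine-Hugoniot condition on the
   curve [a]; a single delta shock is the case [a = b], [qm = qr], [fm = fr]. *)
Lemma weak_balance_delta_three_states
    (a da b db ql qm qr fl fm fr w dw : R -> R) (s : R) (q f : R -> R -> R) :
  (forall t, is_derive a t (da t)) -> (forall t, is_derive b t (db t)) ->
  (forall t, continuous da t) -> (forall t, continuous db t) ->
  a 0 = 0 -> b 0 = 0 -> (forall t, 0 <= t -> a t <= b t) ->
  (forall t, is_derive ql t s) -> (forall t, is_derive qm t s) ->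
  (forall t, is_derive qr t s) ->
  w 0 = 0 -> (forall t, is_derive w t (dw t)) -> (forall t, continuous dw t) ->
  (forall t, (fl t - ql t * da t) - (fm t - qm t * da t) = dw t) ->
  (forall t, fm t - qm t * db t = fr t - qr t * db t) ->
  (forall t x, x <> a t -> x <> b t ->
    q t x = three_states (a t) (b t) (ql t) (qm t) (qr t) x) ->
  (forall t x, x <> a t -> x <> b t ->
    f t x = three_states (a t) (b t) (fl t) (fm t) (fr t) x) ->
  weak_balance_delta a q w f (fun t => w t * da t) s (riemann_step (ql 0) (qr 0)).
Proof.
  intros Ha Hb Cda Cdb Ha0 Hb0 Hab Hql Hqm Hqr Hw0 Hw Cdw RHa RHb Hq Hf phi Hphi.
  destruct (test_function_jet phi Hphi) as (K & P & HP & HphiP).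
  (* The unbounded outer regions are cut by the fixed curves [- K] and [K], on which the test
     function vanishes. *)
  set (lo := fun _ : R => - K). set (hi := fun _ : R => K). set (d0 := fun _ : R => 0).
  assert (HK : 0 < K) by apply HP.
  assert (Hlo : forall t, is_derive lo t (d0 t))
    by (intros; apply is_derive_Reals, derivable_pt_lim_const).
  assert (Hhi : forall t, is_derive hi t (d0 t))
    by (intros; apply is_derive_Reals, derivable_pt_lim_const).
  assert (Cd0 : forall t, continuous d0 t) by (intros; apply continuous_const).
  assert (Ca : forall t, continuous a t) by (intros; eapply is_derive_continuous, Ha).
  assert (Cw : forall t, continuous w t) by (intros; eapply is_derive_continuous, Hw).
  set (mass := fun t => region_mass (P := P) ql lo a t + region_mass (P := P) qm a b t
    + region_mass (P := P) qr b hi t).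
  set (rate := fun t => region_rate (P := P) s ql lo d0 a da t
    + region_rate (P := P) s qm a da b db t + region_rate (P := P) s qr b db hi d0 t).
  (* The Rankine-Hugoniot deficit on the curve [a]: what the three regions leave over and the Dirac
     mass has to compensate. *)
  set (e := fun t => dw t * P O O t (a t)).
  assert (Ce : forall t, continuous e t).
  { intros t. apply continuous_Rmult; [apply Cdw|]. now apply (jet_continuous_curve HP). }
  assert (He : exists I : R, is_int_time e I).
  { exists (RInt e 0 K). apply (is_int_time_compact _ K).
    - intros t Ht. unfold e. rewrite (jet_zero_late HP) by exact Ht. ring.
    - apply (RInt_correct (V := R_CompleteNormedModule)).
      apply (ex_RInt_continuous (V := R_CompleteNormedModule)). auto. }
  destruct He as [I He].
  assert (Hrate : is_int_time rate (- mass 0)).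
  { apply (is_int_time_derive _ _ K HK).
    - intros t. apply is_derive_Rplus; [apply is_derive_Rplus|];
        now apply (region_mass_is_derive HP).
    - intros t. apply continuous_Rplus; [apply continuous_Rplus|];
        now apply (region_rate_continuous HP).
    - intros t Ht. unfold mass, rate, region_mass, region_rate.
      rewrite !(jet_RInt_late HP), !(jet_zero_late HP) by exact Ht. split; ring. }
  (* The regions give the integral of [rate + e]. Along the curve, the derivative of
     [w phi(t, a(t))] is [e] plus the tested Dirac terms and integrates to zero since [w 0 = 0], so
     those terms contribute [- I]. *)
  exists (- mass 0 + I), (- I), (mass 0). repeat split.
  - exists (fun t => rate t + e t). split.
    + intros t Ht.
      replace (rate t + e t) with
        (RInt (fun x => ql t * P 1%nat O t x + fl t * P O 1%nat t x + s * P O O t x)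
           (lo t) (a t) +
         RInt (fun x => qm t * P 1%nat O t x + fm t * P O 1%nat t x + s * P O O t x)
           (a t) (b t) +
         RInt (fun x => qr t * P 1%nat O t x + fr t * P O 1%nat t x + s * P O O t x)
           (b t) (hi t)).
      * assert (C : forall p r x, continuous
          (fun x => p * P 1%nat O t x + r * P O 1%nat t x + s * P O O t x) x).
        { intros p r x. apply continuous_Rplus; [apply continuous_Rplus|];
            (apply continuous_Rmult; [apply continuous_const|apply (jet_continuous_x HP)]). }
        assert (Z : forall p r x, K <= Rabs x ->
          p * P 1%nat O t x + r * P O 1%nat t x + s * P O O t x = 0).
        { intros p r x Hx. destruct HP as (_ & _ & H0). rewrite !H0 by now right. ring. }
        apply is_int_line_three_states; auto.
        intros x Hxa Hxb. rewrite Hq, Hf by assumption. destruct (HphiP t x) as (-> & -> & ->).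
        unfold three_states.
        destruct (Rlt_dec x (a t)); [|destruct (Rlt_dec (b t) x)]; reflexivity.
      * rewrite (RInt_region HP s ql fl lo d0 a da), (RInt_region HP s qm fm a da b db),
          (RInt_region HP s qr fr b db hi d0).
        change (P O O t (lo t)) with (P O O t (- K)).
        change (P O O t (hi t)) with (P O O t K).
        unfold rate, e. rewrite (jet_zero_pos HP), (jet_zero_neg HP), <- RHa.
        rewrite (RHb t). ring.
    + apply (is_RInt_gen_plus (V := R_NormedModule) rate e); assumption.
  - assert (EI : - I = - (w 0 * P O O 0 (a 0)) + - I) by (rewrite Hw0; ring).
    rewrite EI.
    set (dcurve := fun t => dw t * P O O t (a t) +
      w t * (P 1%nat O t (a t) + P O 1%nat t (a t) * da t)).
    assert (Edc : forall t, dcurve t + - e t =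
      w t * dt phi t (a t) + w t * da t * dx phi t (a t)).
    { intros t. unfold dcurve, e. destruct (HphiP t (a t)) as (_ & -> & ->). ring. }
    unfold is_int_time. apply (is_RInt_gen_ext (fun t => dcurve t + - e t)).
    { apply filter_forall. intros _ t _. apply Edc. }
    apply (is_RInt_gen_plus (V := R_NormedModule) dcurve (fun t => - e t)).
    + apply (is_int_time_derive (fun t => w t * P O O t (a t)) dcurve K HK).
      * intros t. apply (is_derive_Rmult w (fun t => P O O t (a t))); [apply Hw|].
        now apply (jet_is_derive_curve HP).
      * intros t. unfold dcurve.
        assert (CP := fun i j => jet_continuous_curve HP i j a t (Ca t)).
        apply continuous_Rplus; (apply continuous_Rmult; [auto|]); [apply CP|].
        apply continuous_Rplus; [apply CP|]. apply continuous_Rmult; [apply CP|apply Cda].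
      * intros t Ht. unfold dcurve. rewrite !(jet_zero_late HP) by exact Ht. split; ring.
    + apply (is_RInt_gen_opp (V := R_NormedModule) e). exact He.
  - replace (mass 0) with
      (RInt (fun x => ql 0 * P O O 0 x) (- K) 0 + RInt (fun x => qr 0 * P O O 0 x) 0 0
       + RInt (fun x => qr 0 * P O O 0 x) 0 K).
    + assert (C : forall p x, continuous (fun x => p * P O O 0 x) x).
      { intros p x. apply continuous_Rmult;
          [apply continuous_const|apply (jet_continuous_x HP)]. }
      assert (Z : forall p x, K <= Rabs x -> p * P O O 0 x = 0).
      { intros p x Hx. destruct HP as (_ & _ & H0). rewrite H0 by now right. ring. }
      apply is_int_line_three_states; auto; [lra|].
      intros x _ _. rewrite riemann_step_three_states. destruct (HphiP 0 x) as (-> & _ & _).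
      unfold three_states.
      destruct (Rlt_dec x 0); [|destruct (Rlt_dec 0 x)]; reflexivity.
    + unfold mass, region_mass, lo, hi. rewrite Ha0, Hb0.
      rewrite !RInt_point.
      rewrite !(RInt_scal (V := R_CompleteNormedModule) (P O O 0))
        by apply (jet_ex_RInt HP).
      change (zero : R_CompleteNormedModule) with 0. unfold scal; simpl. unfold mult; simpl.
      ring.
  - ring.
Qed.

Lemma weak_balance_three_states
    (a da b db ql qm qr fl fm fr : R -> R) (s : R) (q f : R -> R -> R) :
  (forall t, is_derive a t (da t)) -> (forall t, is_derive b t (db t)) ->
  (forall t, continuous da t) -> (forall t, continuous db t) ->
  a 0 = 0 -> b 0 = 0 -> (forall t, 0 <= t -> a t <= b t) ->
  (forall t, is_derive ql t s) -> (forall t, is_derive qm t s) ->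
  (forall t, is_derive qr t s) ->
  (forall t, fl t - ql t * da t = fm t - qm t * da t) ->
  (forall t, fm t - qm t * db t = fr t - qr t * db t) ->
  (forall t x, x <> a t -> x <> b t ->
    q t x = three_states (a t) (b t) (ql t) (qm t) (qr t) x) ->
  (forall t x, x <> a t -> x <> b t ->
    f t x = three_states (a t) (b t) (fl t) (fm t) (fr t) x) ->
  weak_balance q f s (riemann_step (ql 0) (qr 0)).
Proof.
  intros Ha Hb Cda Cdb Ha0 Hb0 Hab Hql Hqm Hqr RHa RHb Hq Hf phi Hphi.
  destruct (weak_balance_delta_three_states a da b db ql qm qr fl fm fr
    (fun _ => 0) (fun _ => 0) s q f) with (phi := phi) as (A & C & B & HA & HC & HB & E);
    trivial.
  - intros t. apply is_derive_Reals, derivable_pt_lim_const.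
  - intros t. apply continuous_const.
  - intros t. rewrite RHa. ring.
  - exists A, B. repeat split; trivial.
    (* With zero weight the singular integrand is identically zero, and the value of a convergent
       integral is unique. *)
    replace C with 0 in E; [lra|].
    apply (is_int_time_unique _ _ _) with (2 := HC).
    apply (is_int_time_compact _ 0); [intros; ring|].
    apply is_RInt_zero. intros; ring.
Qed.

(** * Convergence to a Dirac mass *)

Section RealLimits.

Context {T : Type} {F : (T -> Prop) -> Prop} {FF : Filter F}.

Lemma filterlim_Rconst (c : R) : filterlim (fun _ : T => c) F (locally c).
Proof. apply filterlim_const. Qed.

Lemma filterlim_Rplus (f g : T -> R) (lf lg : R) :
  filterlim f F (locally lf) -> filterlim g F (locally lg) ->
  filterlim (fun x => f x + g x) F (locally (lf + lg)).
Proof.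
  intros Hf Hg. apply (filterlim_comp_2 f g Rplus Hf Hg).
  apply (filterlim_plus (K := R_AbsRing) (V := R_NormedModule)).
Qed.

Lemma filterlim_Rmult (f g : T -> R) (lf lg : R) :
  filterlim f F (locally lf) -> filterlim g F (locally lg) ->
  filterlim (fun x => f x * g x) F (locally (lf * lg)).
Proof.
  intros Hf Hg. apply (filterlim_comp_2 f g Rmult Hf Hg).
  apply (filterlim_mult (K := R_AbsRing)).
Qed.

Lemma filterlim_Ropp (f : T -> R) (lf : R) :
  filterlim f F (locally lf) -> filterlim (fun x => - f x) F (locally (- lf)).
Proof.
  intros Hf. apply (filterlim_comp _ _ _ f Ropp F _ _ Hf).
  apply (filterlim_opp (K := R_AbsRing) (V := R_NormedModule)).
Qed.

Lemma filterlim_Rminus (f g : T -> R) (lf lg : R) :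
  filterlim f F (locally lf) -> filterlim g F (locally lg) ->
  filterlim (fun x => f x - g x) F (locally (lf - lg)).
Proof. intros Hf Hg. apply filterlim_Rplus; [exact Hf|now apply filterlim_Ropp]. Qed.

Lemma filterlim_dist_0 (f : T -> R) (l : R) :
  filterlim f F (locally l) -> filterlim (fun x => Rabs (f x - l)) F (locally 0).
Proof.
  intros H. apply filterlim_locally. intros eps.
  apply (filterlim_locally f l) with (eps := eps) in H. revert H.
  apply filter_imp. intros x Hx. change (Rabs (f x - l) < eps) in Hx.
  change (Rabs (Rabs (f x - l) - 0) < eps). now rewrite Rminus_0_r, Rabs_Rabsolu.
Qed.

Lemma filterlim_squeeze (f g : T -> R) (l : R) :
  F (fun x => Rabs (f x - l) <= g x) -> filterlim g F (locally 0) ->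
  filterlim f F (locally l).
Proof.
  intros Hfg Hg. apply filterlim_locally. intros eps.
  apply (filterlim_locally g 0) with (eps := eps) in Hg.
  generalize (filter_and _ _ Hfg Hg). apply filter_imp. intros x [H1 H2].
  change (Rabs (g x - 0) < eps) in H2. change (Rabs (f x - l) < eps).
  rewrite Rminus_0_r in H2. apply Rle_lt_trans with (1 := H1).
  apply Rle_lt_trans with (2 := H2). apply Rle_abs.
Qed.

Lemma filterlim_eq (f g : T -> R) (l l' : R) :
  F (fun x => f x = g x) -> l = l' -> filterlim f F (locally l) ->
  filterlim g F (locally l').
Proof. intros H <-. now apply filterlim_ext_loc. Qed.

End RealLimits.

Lemma continuity_2d_bounded (f : R -> R -> R) (a b c d : R) :
  (forall t x, continuity_2d_pt f t x) ->
  exists M, forall t x, a <= t <= b -> c <= x <= d -> Rabs (f t x) <= M.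
Proof.
  intros Hf.
  assert (Hd : forall u v, {e : posreal | forall t x,
    Rabs (t - u) < e -> Rabs (x - v) < e -> Rabs (f t x - f u v) < 1}).
  { intros u v. apply constructive_indefinite_description. apply (Hf u v posreal_one). }
  assert (Hp : forall u v, 0 < Rmin (proj1_sig (Hd u v)) (/ (Rabs (f u v) + 1))).
  { intros u v. apply Rmin_pos; [apply cond_pos|].
    apply Rinv_0_lt_compat. pose proof (Rabs_pos (f u v)). lra. }
  (* The radius at [(u, v)] also encodes a bound on [|f u v|], so that a uniform
     lower bound on the radii bounds [f]. *)
  destruct (compactness_value_2d a b c d (fun u v => mkposreal _ (Hp u v))) as [r Hr].
  exists (/ r + 1). intros t x Ht Hx. apply Rnot_lt_le. intros Hlt.
  apply (Hr t x Ht Hx). intros (u & v & _ & _ & H1 & H2 & H3). simpl in H1, H2, H3.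
  destruct (Hd u v) as [e He]. simpl in *.
  assert (H4 := He t x (Rlt_le_trans _ _ _ H1 (Rmin_l _ _))
    (Rlt_le_trans _ _ _ H2 (Rmin_l _ _))).
  assert (H5 := Rle_trans _ _ _ H3 (Rmin_r _ _)).
  assert (H6 : Rabs (f u v) + 1 <= / r).
  { rewrite <- (Rinv_inv (Rabs (f u v) + 1)).
    apply Rinv_le_contravar; [apply cond_pos|exact H5]. }
  assert (H7 : Rabs (f t x) <= Rabs (f t x - f u v) + Rabs (f u v)).
  { replace (f t x) with ((f t x - f u v) + f u v) at 1 by ring. apply Rabs_triang. }
  lra.
Qed.

(** The endpoints are unordered because a shock may lie on either side of the limiting delta
    curve. *)
Lemma abs_RInt_le (f : R -> R) (M y z : R) :
  (forall a b, ex_RInt f a b) -> (forall x, Rabs (f x) <= M) ->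
  Rabs (RInt f y z) <= M * Rabs (z - y).
Proof.
  intros Hf HM. destruct (Rle_dec y z) as [H|H].
  - rewrite (Rabs_pos_eq (z - y)) by lra. rewrite Rmult_comm.
    apply abs_RInt_le_const; auto.
  - rewrite <- (opp_RInt_swap (V := R_CompleteNormedModule)) by apply Hf.
    change (Rabs (- RInt f z y) <= M * Rabs (z - y)).
    rewrite Rabs_Ropp, (Rabs_left1 (z - y)), Ropp_minus_distr, Rmult_comm by lra.
    apply abs_RInt_le_const; auto; lra.
Qed.

Section JetBounds.

Context {K : R} {P : nat -> nat -> R -> R -> R} (HP : compact_jet K P).

Lemma jet_bounded i j : exists M, 0 <= M /\ forall t x, Rabs (P i j t x) <= M.
Proof.
  destruct (continuity_2d_bounded (P i j) (- K) K (- K) K) as [M HM];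
    [apply (jet_continuity_2d HP)|].
  assert (HK : 0 < K) by apply HP.
  assert (HM0 : 0 <= M).
  { apply Rle_trans with (1 := Rabs_pos (P i j 0 0)). apply HM; lra. }
  exists M. split; [exact HM0|]. intros t x.
  destruct (Rlt_dec (Rabs t) K) as [Ht|Ht]; [destruct (Rlt_dec (Rabs x) K) as [Hx|Hx]|].
  - apply Rabs_def2 in Ht. apply Rabs_def2 in Hx. apply HM; lra.
  - destruct HP as (_ & _ & H0). rewrite H0, Rabs_R0; [exact HM0|lra].
  - destruct HP as (_ & _ & H0). rewrite H0, Rabs_R0; [exact HM0|lra].
Qed.

Lemma region_mass_continuous (q a b : R -> R) t :
  continuous q t -> ex_derive a t -> ex_derive b t ->
  continuous (region_mass (P := P) q a b) t.
Proof.
  intros Hq Ha Hb. apply continuous_Rmult; [exact Hq|].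
  now apply (jet_continuous_RInt HP).
Qed.

(** This turns the improper iterated integral into a proper one over the fixed interval [[0, K]], so
    convergence in [gamma] can be read from a bound on the integrand there. *)
Lemma is_int_half_plane_three_states (a b ql qm qr : R -> R) (f phi : R -> R -> R) :
  (forall t x, phi t x = P O O t x) ->
  (forall t, ex_derive a t) -> (forall t, ex_derive b t) ->
  (forall t, 0 <= t -> a t <= b t) ->
  (forall t, continuous ql t) -> (forall t, continuous qm t) ->
  (forall t, continuous qr t) ->
  (forall t x, 0 <= t -> f t x = three_states (a t) (b t) (ql t) (qm t) (qr t) x) ->
  is_int_half_plane (fun t x => f t x * phi t x)
    (RInt (fun t => region_mass (P := P) ql (fun _ => - K) a t
       + region_mass (P := P) qm a b t
       + region_mass (P := P) qr b (fun _ => K) t) 0 K).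
Proof.
  intros Hphi Ha Hb Hab Cl Cm Cr Hf.
  assert (Ec : forall c t : R, ex_derive (fun _ : R => c) t).
  { intros c t. exists 0. apply is_derive_Reals, derivable_pt_lim_const. }
  exists (fun t => region_mass (P := P) ql (fun _ => - K) a t
       + region_mass (P := P) qm a b t
       + region_mass (P := P) qr b (fun _ => K) t). split.
  - intros t Ht. unfold region_mass.
    assert (E : forall q y z, q * RInt (P O O t) y z = RInt (fun x => q * P O O t x) y z).
    { intros q y z. symmetry.
      apply (RInt_scal (V := R_CompleteNormedModule) (P O O t)), (jet_ex_RInt HP). }
    rewrite !E.
    assert (C : forall p x, continuous (fun x => p * P O O t x) x).
    { intros p x. apply continuous_Rmult;
        [apply continuous_const|apply (jet_continuous_x HP)]. }
    assert (Z : forall p x, K <= Rabs x -> p * P O O t x = 0).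
    { intros p x Hx. destruct HP as (_ & _ & H0). rewrite H0 by now right. ring. }
    apply is_int_line_three_states; auto.
    intros x _ _. rewrite Hf, Hphi by exact Ht. unfold three_states.
    destruct (Rlt_dec x (a t)); [|destruct (Rlt_dec (b t) x)]; reflexivity.
  - apply (is_int_time_compact _ K).
    + intros t Ht. unfold region_mass. rewrite !(jet_RInt_late HP) by exact Ht. ring.
    + apply (RInt_correct (V := R_CompleteNormedModule)).
      apply (ex_RInt_continuous (V := R_CompleteNormedModule)). intros t _.
      apply continuous_Rplus; [apply continuous_Rplus|]; now apply region_mass_continuous.
Qed.

(** The integrand minus its value at [c] is an integral of [phi_x], hence at most [L] times the
    distance to [c]. The factor [z - y] on the right is essential: it is what absorbs the unbounded
    height of the strip. *)
Lemma jet_RInt_flat_error (L t y z c : R) :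
  (forall u x, Rabs (P O 1%nat u x) <= L) -> y <= z ->
  Rabs (RInt (P O O t) y z - (z - y) * P O O t c) <=
    (z - y) * (L * (Rabs (y - c) + Rabs (z - c))).
Proof.
  intros HL Hyz.
  assert (HL0 : 0 <= L) by exact (Rle_trans _ _ _ (Rabs_pos _) (HL 0 0)).
  replace (RInt (P O O t) y z - (z - y) * P O O t c)
    with (RInt (fun x => P O O t x - P O O t c) y z).
  - apply abs_RInt_le_const; [exact Hyz| |].
    + apply (ex_RInt_minus (V := R_NormedModule) (P O O t) (fun _ => P O O t c));
        [apply (jet_ex_RInt HP)|apply ex_RInt_const].
    + intros x Hx. rewrite <- (jet_RInt_x HP).
      apply Rle_trans with (L * Rabs (x - c)).
      * apply abs_RInt_le; [intros; apply (jet_ex_RInt HP)|apply HL].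
      * apply Rmult_le_compat_l; [exact HL0|].
        unfold Rabs; repeat destruct Rcase_abs; lra.
  - rewrite (RInt_minus (V := R_CompleteNormedModule) (P O O t) (fun _ => P O O t c));
      [|apply (jet_ex_RInt HP)|apply ex_RInt_const].
    rewrite RInt_const. reflexivity.
Qed.

End JetBounds.

(** Motion from the origin with initial speed [s] and acceleration [beta]. Both shocks and the delta
    shock follow such paths, and two of them are at distance proportional to [t]. *)
Definition accelerated (beta s t : R) : R := s * t + / 2 * beta * t ^ 2.

Lemma accelerated_is_derive beta s t : is_derive (accelerated beta s) t (s + beta * t).
Proof. unfold accelerated. auto_derive; [trivial|field]. Qed.

Lemma continuous_bounded (q : R -> R) (a b : R) :
  (forall t, continuous q t) -> exists M, 0 <= M /\ forall t, a <= t <= b -> Rabs (q t) <= M.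
Proof.
  intros H. destruct (bounded_continuity q a b) as [M HM]; [intros; apply H|].
  exists (Rabs M). split; [apply Rabs_pos|]. intros t Ht.
  apply Rle_trans with M; [apply Rlt_le, HM, Ht|apply Rle_abs].
Qed.

(* The middle strip has width [(s2 - s1) t], so its total mass tends to
   [(alpha + alpha' t) t] even though the middle value itself may blow up. *)
Lemma converges_three_states (beta sigma alpha alpha' : R)
    (ql qm0 qr X w : R -> R) (s1 s2 A B : R -> R)
    (f : R -> R -> R -> R) (f0 : R -> R -> R) :
  (forall t, continuous ql t) -> (forall t, continuous qm0 t) ->
  (forall t, continuous qr t) ->
  (forall t, X t = accelerated beta sigma t) ->
  (forall t, w t = (alpha + alpha' * t) * t) ->
  (forall t x, f0 t x = three_states (X t) (X t) (ql t) (qm0 t) (qr t) x) ->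
  at_right 1 (fun gamma => s1 gamma <= s2 gamma) ->
  at_right 1 (fun gamma => forall t x,
    f gamma t x =
      three_states (accelerated beta (s1 gamma) t) (accelerated beta (s2 gamma) t)
        (ql t) (A gamma + B gamma * t) (qr t) x) ->
  filterlim s1 (at_right 1) (locally sigma) ->
  filterlim s2 (at_right 1) (locally sigma) ->
  filterlim (fun g => A g * (s2 g - s1 g)) (at_right 1) (locally alpha) ->
  filterlim (fun g => B g * (s2 g - s1 g)) (at_right 1) (locally alpha') ->
  converges_in_distributions f f0 X w.
Proof.
  intros Cl Cm Cr HX Hw Hf0 Hs Hf Ls1 Ls2 LA LB phi Hphi.
  destruct (test_function_jet phi Hphi) as (K & P & HP & HphiP).
  assert (HK : 0 < K) by apply HP.
  assert (Hacc : forall s t, ex_derive (accelerated beta s) t)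
    by (intros; eexists; apply accelerated_is_derive).
  assert (Hac : forall s t, continuous (accelerated beta s) t)
    by (intros; eapply is_derive_continuous, accelerated_is_derive).
  assert (HcX : forall t, ex_derive X t).
  { intros t. apply (ex_derive_ext (accelerated beta sigma)); [|apply Hacc].
    intros s. symmetry. apply HX. }
  assert (Ec : forall c t : R, ex_derive (fun _ : R => c) t).
  { intros c t. exists 0. apply is_derive_Reals, derivable_pt_lim_const. }
  assert (CX : forall t, continuous X t).
  { intros t. destruct (HcX t) as [l Hl]. apply (is_derive_continuous _ _ _ Hl). }
  assert (Caff : forall c d t, continuous (fun t => c + d * t) t).
  { intros. apply continuous_Rplus; [|apply continuous_Rmult];
      try apply continuous_const; apply continuous_id. }
  assert (Cw : forall t, continuous w t).
  { intros t. apply (continuous_ext (fun t => (alpha + alpha' * t) * t)).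
    - intros u. symmetry. apply Hw.
    - apply continuous_Rmult; [apply Caff|apply continuous_id]. }
  set (lo := fun _ : R => - K). set (hi := fun _ : R => K).
  set (c1 g := accelerated beta (s1 g)). set (c2 g := accelerated beta (s2 g)).
  set (qm g t := A g + B g * t).
  set (m g t := region_mass (P := P) ql lo (c1 g) t + region_mass (P := P) (qm g) (c1 g) (c2 g) t
    + region_mass (P := P) qr (c2 g) hi t).
  set (m0 t := region_mass (P := P) ql lo X t + region_mass (P := P) qm0 X X t
    + region_mass (P := P) qr X hi t).
  set (e t := w t * P O O t (X t)).
  assert (Cm' : forall g t, continuous (m g) t).
  { intros g t. apply continuous_Rplus; [apply continuous_Rplus|];
      apply (region_mass_continuous HP);
      unfold c1, c2, qm; auto; apply Ec. }
  assert (Cm0 : forall t, continuous m0 t).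
  { intros t. apply continuous_Rplus; [apply continuous_Rplus|];
      apply (region_mass_continuous HP); auto;
      apply Ec. }
  assert (Ce : forall t, continuous e t).
  { intros t. apply continuous_Rmult; [apply Cw|now apply (jet_continuous_curve HP)]. }
  assert (Ex : forall k : R -> R, (forall t, continuous k t) -> ex_RInt k 0 K).
  { intros k Hk. apply (ex_RInt_continuous (V := R_CompleteNormedModule)). auto. }
  exists (fun g => RInt (m g) 0 K), (RInt m0 0 K), (RInt e 0 K).
  split; [|split; [|split]].
  - generalize (filter_and _ _ Hs Hf). apply filter_imp. intros g [H1 H2].
    apply (is_int_half_plane_three_states HP); unfold c1, c2, qm; auto.
    + apply HphiP.
    + intros t Ht. unfold accelerated. apply Rplus_le_compat_r.
      now apply Rmult_le_compat_r.
  - apply (is_int_half_plane_three_states HP); auto; [apply HphiP|].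
    intros. apply Rle_refl.
  - unfold is_int_time. apply (is_RInt_gen_ext e).
    { apply filter_forall. intros _ t _. unfold e. now destruct (HphiP t (X t)) as (-> & _). }
    apply (is_int_time_compact _ K).
    + intros t Ht. unfold e. rewrite (jet_zero_late HP) by exact Ht. ring.
    + now apply (RInt_correct (V := R_CompleteNormedModule)), Ex.
  - destruct (jet_bounded HP O O) as (M & HM0 & HM).
    destruct (jet_bounded HP O 1) as (L & HL0 & HL).
    destruct (continuous_bounded ql 0 K Cl) as (Ql & HQl0 & HQl).
    destruct (continuous_bounded qr 0 K Cr) as (Qr & HQr0 & HQr).
    set (e1 g := Rabs (s1 g - sigma)). set (e2 g := Rabs (s2 g - sigma)).
    set (eA g := Rabs (A g * (s2 g - s1 g) - alpha)).
    set (eB g := Rabs (B g * (s2 g - s1 g) - alpha')).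
    (* Four errors: displacement of the left state, displacement of the right state, variation of
       the test function across the strip, and deviation of the strip mass from its limit. *)
    set (C g := Ql * (M * K) * e1 g + Qr * (M * K) * e2 g
      + (Rabs alpha + eA g + K * (Rabs alpha' + eB g)) * (K * L * K * (e1 g + e2 g))
      + (eA g + K * eB g) * (K * M)).
    apply (filterlim_squeeze _ (fun g => K * C g)).
    + revert Hs. apply filter_imp. intros g Hg.
      replace (RInt (m g) 0 K - (RInt m0 0 K + RInt e 0 K))
        with (RInt (fun t => m g t - (m0 t + e t)) 0 K).
      2:{ rewrite (RInt_minus (V := R_CompleteNormedModule) (m g) (fun t => m0 t + e t)).
          - rewrite (RInt_plus (V := R_CompleteNormedModule) m0 e) by now apply Ex.
            reflexivity.
          - now apply Ex.
          - apply Ex. intros. now apply continuous_Rplus. }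
      replace (K * C g) with ((K - 0) * C g) by ring.
      apply abs_RInt_le_const; [lra| |].
      { apply Ex. intros. apply continuous_Rminus; [apply Cm'|now apply continuous_Rplus]. }
      intros t Ht.
      assert (Hp : forall y z u, RInt (P O O t) y z + RInt (P O O t) z u = RInt (P O O t) y u).
      { intros. apply (RInt_Chasles (V := R_CompleteNormedModule));
          apply (jet_ex_RInt HP). }
      assert (Hb : forall y z, Rabs (RInt (P O O t) y z) <= M * Rabs (z - y)).
      { intros. apply abs_RInt_le; [intros; apply (jet_ex_RInt HP)|apply HM]. }
      set (y1 := c1 g t). set (y2 := c2 g t). set (x0 := X t).
      assert (D1 : y1 - x0 = (s1 g - sigma) * t).
      { unfold y1, x0, c1. rewrite HX. unfold accelerated. ring. }
      assert (D2 : y2 - x0 = (s2 g - sigma) * t).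
      { unfold y2, x0, c2. rewrite HX. unfold accelerated. ring. }
      assert (A1 : Rabs (y1 - x0) <= K * e1 g).
      { rewrite D1, Rabs_mult, (Rabs_pos_eq t), Rmult_comm by lra.
        apply Rmult_le_compat_r; [apply Rabs_pos|lra]. }
      assert (A2 : Rabs (y2 - x0) <= K * e2 g).
      { rewrite D2, Rabs_mult, (Rabs_pos_eq t), Rmult_comm by lra.
        apply Rmult_le_compat_r; [apply Rabs_pos|lra]. }
      assert (Hy : y2 - y1 = (s2 g - s1 g) * t) by lra.
      assert (Hy0 : 0 <= y2 - y1) by (rewrite Hy; apply Rmult_le_pos; lra).
      set (err := RInt (P O O t) y1 y2 - (y2 - y1) * P O O t x0).
      assert (Herr : Rabs err <= (y2 - y1) * (L * (Rabs (y1 - x0) + Rabs (y2 - x0)))).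
      { apply (jet_RInt_flat_error HP); [exact HL|lra]. }
      (* Splitting the outer integrals at the delta curve [x0] leaves oriented integrals over the
         displacements. The strip integral is split into [err] and width times the value at [x0],
         which is compared with the Dirac term. *)
      replace (m g t - (m0 t + e t)) with
        (ql t * RInt (P O O t) x0 y1 + qr t * RInt (P O O t) y2 x0 + qm g t * err
         + (qm g t * (s2 g - s1 g) - (alpha + alpha' * t)) * t * P O O t x0).
      2:{ unfold m, m0, e, region_mass, err, lo, hi. fold y1 y2 x0.
          rewrite RInt_point. change (zero : R_CompleteNormedModule) with 0.
          rewrite <- (Hp (- K) x0 y1), <- (Hp y2 x0 K), Hw, Hy. ring. }
      assert (B1 : Rabs (ql t * RInt (P O O t) x0 y1) <= Ql * (M * K) * e1 g).
      { rewrite Rabs_mult, Rmult_assoc.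
        apply Rmult_le_compat; try apply Rabs_pos; [now apply HQl|].
        apply Rle_trans with (1 := Hb _ _). rewrite Rmult_assoc.
        now apply Rmult_le_compat_l. }
      assert (B2 : Rabs (qr t * RInt (P O O t) y2 x0) <= Qr * (M * K) * e2 g).
      { rewrite Rabs_mult, Rmult_assoc.
        apply Rmult_le_compat; try apply Rabs_pos; [now apply HQr|].
        apply Rle_trans with (1 := Hb _ _). rewrite Rmult_assoc, Rabs_minus_sym.
        now apply Rmult_le_compat_l. }
      (* The height [qm] alone has no bound; its product with the speed gap does, so the estimate of
         [qm * err] must keep the two factors together. *)
      assert (Hqd : Rabs (qm g t * (s2 g - s1 g)) <=
        Rabs alpha + eA g + K * (Rabs alpha' + eB g)).
      { replace (qm g t * (s2 g - s1 g)) with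
          ((alpha + (A g * (s2 g - s1 g) - alpha)) +
           t * (alpha' + (B g * (s2 g - s1 g) - alpha'))) by (unfold qm; ring).
        apply Rle_trans with (1 := Rabs_triang _ _).
        apply Rplus_le_compat; [apply Rabs_triang|].
        rewrite Rabs_mult, (Rabs_pos_eq t) by lra.
        apply Rmult_le_compat; [lra|apply Rabs_pos|lra|apply Rabs_triang]. }
      assert (B3 : Rabs (qm g t * err) <=
        (Rabs alpha + eA g + K * (Rabs alpha' + eB g)) * (K * L * K * (e1 g + e2 g))).
      { rewrite Rabs_mult.
        apply Rle_trans with (Rabs (qm g t) *
          ((y2 - y1) * (L * (Rabs (y1 - x0) + Rabs (y2 - x0)))));
          [apply Rmult_le_compat_l; [apply Rabs_pos|exact Herr]|].
        rewrite Hy.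
        replace (Rabs (qm g t) * ((s2 g - s1 g) * t *
            (L * (Rabs (y1 - x0) + Rabs (y2 - x0)))))
          with (Rabs (qm g t * (s2 g - s1 g)) *
            (t * L * (Rabs (y1 - x0) + Rabs (y2 - x0))))
          by (rewrite Rabs_mult, (Rabs_pos_eq (s2 g - s1 g)) by lra; ring).
        assert (N1 := Rabs_pos (y1 - x0)). assert (N2 := Rabs_pos (y2 - x0)).
        apply Rmult_le_compat; [apply Rabs_pos| |exact Hqd|].
        - apply Rmult_le_pos; [apply Rmult_le_pos|]; lra.
        - rewrite (Rmult_assoc (K * L)). apply Rmult_le_compat; [| |
            apply Rmult_le_compat_r|]; try lra.
          apply Rmult_le_pos; lra. }
      assert (B4 : Rabs ((qm g t * (s2 g - s1 g) - (alpha + alpha' * t)) * t * P O O t x0)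
        <= (eA g + K * eB g) * (K * M)).
      { rewrite Rmult_assoc, Rabs_mult.
        apply Rmult_le_compat; try apply Rabs_pos.
        - replace (qm g t * (s2 g - s1 g) - (alpha + alpha' * t)) with
            ((A g * (s2 g - s1 g) - alpha) + t * (B g * (s2 g - s1 g) - alpha'))
            by (unfold qm; ring).
          apply Rle_trans with (1 := Rabs_triang _ _). apply Rplus_le_compat_l.
          rewrite Rabs_mult, (Rabs_pos_eq t) by lra.
          apply Rmult_le_compat_r; [apply Rabs_pos|lra].
        - rewrite Rabs_mult, (Rabs_pos_eq t) by lra.
          apply Rmult_le_compat; [lra|apply Rabs_pos|lra|apply HM]. }
      unfold C.
      apply Rle_trans with (1 := Rabs_triang _ _). apply Rplus_le_compat; [|exact B4].
      apply Rle_trans with (1 := Rabs_triang _ _). apply Rplus_le_compat; [|exact B3].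
      apply Rle_trans with (1 := Rabs_triang _ _). now apply Rplus_le_compat.
    + assert (L1 : filterlim e1 (at_right 1) (locally 0)) by now apply filterlim_dist_0.
      assert (L2 : filterlim e2 (at_right 1) (locally 0)) by now apply filterlim_dist_0.
      assert (L3 : filterlim eA (at_right 1) (locally 0))
        by now apply (filterlim_dist_0 (fun g => A g * (s2 g - s1 g))).
      assert (L4 : filterlim eB (at_right 1) (locally 0))
        by now apply (filterlim_dist_0 (fun g => B g * (s2 g - s1 g))).
      (* The limit is left open, assembled termwise from the structure of [C], and only then
         simplified to 0. *)
      eapply filterlim_eq; [apply filter_forall; intros; reflexivity| |].
      2:{ unfold C. repeat first [apply filterlim_Rmult | apply filterlim_Rplus
            | eassumption | apply filterlim_Rconst]. }
      ring.
Qed.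

(** * The intermediate state *)

Definition velocity_jump (d a r : R) : R :=
  sqrt (d / 2 * (Rpower r d - Rpower a d) * ((r - a) / (r + a))).

(** Both the pressure difference and [a - b] change sign. The formula for the 2-shock lists the
    smaller density first, and this brings it to the form of the 1-shock. *)
Lemma shock_coef_sym (gamma a b : R) :
  0 < a -> 0 < b -> a <> b -> shock_coef gamma a b = shock_coef gamma b a.
Proof. intros Ha Hb Hab. unfold shock_coef. f_equal. field. lra. Qed.

Lemma Rpower_diff_pos (d a r : R) : 0 < d -> 0 < a <= r -> 0 <= Rpower r d - Rpower a d.
Proof. intros Hd H. pose proof (Rle_Rpower_l a r d). lra. Qed.

Lemma velocity_jump_radicand_pos (d a r : R) :
  0 < d -> 0 < a <= r -> 0 <= d / 2 * (Rpower r d - Rpower a d) * ((r - a) / (r + a)).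
Proof.
  intros Hd H. apply Rmult_le_pos; [apply Rmult_le_pos|].
  - lra.
  - now apply Rpower_diff_pos.
  - apply Rdiv_le_0_compat; lra.
Qed.

Lemma shock_coef_velocity_jump (gamma a r : R) :
  1 < gamma -> 0 < a < r ->
  shock_coef gamma r a = velocity_jump (gamma - 1) a r / (r - a).
Proof.
  intros Hg H. apply Rmult_eq_reg_r with (r - a); [|lra].
  unfold Rdiv at 1. rewrite Rmult_assoc, Rinv_l, Rmult_1_r by lra.
  unfold shock_coef, velocity_jump. set (p := Rpower r _ - Rpower a _).
  assert (Hp : 0 <= p) by (apply Rpower_diff_pos; lra).
  rewrite <- (sqrt_square (r - a)) at 2 by lra.
  rewrite <- sqrt_mult_alt.
  - f_equal. field. lra.
  - apply Rdiv_le_0_compat; [apply Rmult_le_pos; lra|apply Rmult_lt_0_compat; lra].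
Qed.

Lemma velocity_jump_pos (d a r : R) : 0 <= velocity_jump d a r.
Proof. apply sqrt_pos. Qed.

Lemma velocity_jump_sqr (d a r : R) :
  0 < d -> 0 < a <= r ->
  velocity_jump d a r ^ 2 * (r + a) = d / 2 * (Rpower r d - Rpower a d) * (r - a).
Proof.
  intros Hd H. unfold velocity_jump.
  rewrite pow2_sqrt by now apply velocity_jump_radicand_pos. field. lra.
Qed.

Lemma velocity_jump_increasing (d a r r' : R) :
  0 < d -> 0 < a <= r -> r < r' -> velocity_jump d a r < velocity_jump d a r'.
Proof.
  intros Hd Ha Hr. apply sqrt_lt_1_alt. split; [now apply velocity_jump_radicand_pos|].
  assert (Hp := Rpower_diff_pos d a r Hd Ha).
  assert (Hl : Rpower r d < Rpower r' d) by (apply Rlt_Rpower_l; lra).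
  apply Rmult_le_0_lt_compat.
  - apply Rmult_le_pos; lra.
  - apply Rdiv_le_0_compat; lra.
  - apply Rmult_lt_compat_l; lra.
  - apply Rlt_0_minus.
    replace ((r' - a) / (r' + a) - (r - a) / (r + a))
      with (2 * a * (r' - r) / ((r' + a) * (r + a))) by (field; lra).
    apply Rdiv_lt_0_compat; repeat apply Rmult_lt_0_compat; lra.
Qed.

Lemma velocity_jump_continuous (d a r : R) :
  0 < a -> 0 < r -> continuous (velocity_jump d a) r.
Proof.
  intros Ha Hr. apply continuous_sqrt_comp.
  apply (ex_derive_continuous
    (fun r => d / 2 * (Rpower r d - Rpower a d) * ((r - a) / (r + a)))).
  unfold Rpower. auto_derive. lra.
Qed.

(** A crude bound uniform in [d], treating [r >= 1] and [r < 1] separately. It suffices because it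
    is always multiplied by [d/2], which tends to 0. *)
Lemma Rpower_le_1_plus (d r : R) : 0 < d <= 1 -> 0 < r -> Rpower r d <= 1 + r.
Proof.
  intros Hd Hr. destruct (Rle_dec 1 r) as [H|H].
  - apply Rle_trans with (Rpower r 1); [apply Rle_Rpower; lra|rewrite Rpower_1; lra].
  - apply Rle_trans with (Rpower 1 d); [apply Rle_Rpower_l; lra|].
    unfold Rpower. rewrite ln_1, Rmult_0_r, exp_0. lra.
Qed.

Lemma velocity_jump_le (d a r : R) :
  0 < d <= 1 -> 0 < a <= r -> velocity_jump d a r <= sqrt (d / 2 * (1 + r)).
Proof.
  intros Hd Ha. apply sqrt_le_1_alt.
  rewrite <- (Rmult_1_r (d / 2 * (1 + r))).
  assert (H1 := Rpower_le_1_plus d r Hd ltac:(lra)).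
  assert (H2 := Rpower_diff_pos d a r ltac:(lra) Ha).
  assert (H3 : 0 < Rpower a d) by apply exp_pos.
  apply Rmult_le_compat.
  - apply Rmult_le_pos; lra.
  - apply Rdiv_le_0_compat; lra.
  - apply Rmult_le_compat_l; lra.
  - apply Rle_div_l; lra.
Qed.

Lemma velocity_jump_unbounded (d a J r0 : R) :
  0 < d -> 0 < a -> 0 < r0 -> exists r, r0 < r /\ J < velocity_jump d a r.
Proof.
  intros Hd Ha Hr0.
  assert (Hpa : 0 < Rpower a d) by apply exp_pos.
  assert (HJ : 0 <= J ^ 2) by apply pow2_ge_0.
  (* The radius will satisfy [r >= 2 a], so [(r - a) / (r + a) >= 1/3], and [r^d >= V]. The constant
     6 then makes the radicand at least [J^2 + 1]. *)
  set (V := Rpower a d + 6 * (J ^ 2 + 1) / d).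
  assert (HV0 : 0 < 6 * (J ^ 2 + 1) / d) by (apply Rdiv_lt_0_compat; lra).
  assert (HV : 0 < V) by (unfold V; lra).
  assert (HR : 0 < Rpower V (/ d)) by apply exp_pos.
  set (r := r0 + 2 * a + Rpower V (/ d)). exists r. split; [unfold r; lra|].
  assert (Hr : V <= Rpower r d).
  { replace V with (Rpower (Rpower V (/ d)) d) at 1.
    - apply Rle_Rpower_l; unfold r; lra.
    - rewrite Rpower_mult, Rinv_l by lra. now apply Rpower_1. }
  apply Rle_lt_trans with (Rabs J); [apply Rle_abs|]. rewrite <- sqrt_Rsqr_abs.
  apply sqrt_lt_1_alt. split; [apply Rle_0_sqr|]. rewrite Rsqr_pow2.
  apply Rlt_le_trans with (d / 2 * (6 * (J ^ 2 + 1) / d) * / 3).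
  - replace (d / 2 * (6 * (J ^ 2 + 1) / d) * / 3) with (J ^ 2 + 1) by (field; lra). lra.
  - apply Rmult_le_compat; [|lra| |].
    + apply Rmult_le_pos; lra.
    + apply Rmult_le_compat_l; unfold V in Hr; lra.
    + apply Rle_div_r; unfold r; lra.
Qed.

(** The smallness condition says [d/2 (1 + M) < (J/2)^2] for [M = Rmax a b], so each jump is below
    [J/2] at [M]. Since a single jump eventually exceeds [J], the intermediate value theorem
    applies. *)
Lemma intermediate_density_exists (d a b J : R) :
  0 < d <= 1 -> 0 < a -> 0 < b -> 0 < J -> d * (2 * (1 + Rmax a b)) < J ^ 2 ->
  exists r, Rmax a b < r /\ velocity_jump d a r + velocity_jump d b r = J.
Proof.
  intros Hd Ha Hb HJ Hsmall. set (M := Rmax a b) in *.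
  assert (HMa : a <= M) by apply Rmax_l. assert (HMb : b <= M) by apply Rmax_r.
  assert (Hat : velocity_jump d a M + velocity_jump d b M < J).
  { assert (Hs : sqrt (d / 2 * (1 + M)) < J / 2).
    { rewrite <- (sqrt_square (J / 2)) by lra. apply sqrt_lt_1_alt.
      split; [apply Rmult_le_pos; lra|]. lra. }
    assert (H1 := velocity_jump_le d a M Hd ltac:(lra)).
    assert (H2 := velocity_jump_le d b M Hd ltac:(lra)). lra. }
  destruct (velocity_jump_unbounded d a J M) as (R1 & HR1 & HJ1); [lra..|].
  destruct (IVT_interv (fun r => velocity_jump d a r + velocity_jump d b r - J) M R1)
    as (r & Hr & Er).
  - intros r Hr. apply continuity_pt_filterlim.
    apply (continuous_Rminus (fun r => velocity_jump d a r + velocity_jump d b r) (fun _ => J));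
      [|apply continuous_const].
    apply (continuous_Rplus (velocity_jump d a) (velocity_jump d b));
      apply velocity_jump_continuous; lra.
  - exact HR1.
  - lra.
  - assert (H := velocity_jump_pos d b R1). lra.
  - exists r. split; [|lra].
    (* The intermediate value theorem only gives [M <= r]; the strict inequality at [M] excludes
       equality. *)
    destruct (Req_dec r M) as [E|E]; [subst r; lra|lra].
Qed.

Lemma intermediate_density_unique (d a b r r' : R) :
  0 < d -> 0 < a -> 0 < b -> Rmax a b < r -> Rmax a b < r' ->
  velocity_jump d a r + velocity_jump d b r =
    velocity_jump d a r' + velocity_jump d b r' -> r = r'.
Proof.
  intros Hd Ha Hb Hr Hr' E.
  assert (HMa := Rmax_l a b). assert (HMb := Rmax_r a b).
  destruct (Rtotal_order r r') as [H|[H|H]]; [|exact H|].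
  - assert (H1 := velocity_jump_increasing d a r r' Hd ltac:(lra) H).
    assert (H2 := velocity_jump_increasing d b r r' Hd ltac:(lra) H). lra.
  - assert (H1 := velocity_jump_increasing d a r' r Hd ltac:(lra) H).
    assert (H2 := velocity_jump_increasing d b r' r Hd ltac:(lra) H). lra.
Qed.

Lemma intermediate_state_velocity_jump (D : riemann_data) (gamma rs vs : R) :
  0 < rho_l D -> 0 < rho_r D -> 1 < gamma ->
  intermediate_state D gamma rs vs <->
  Rmax (rho_l D) (rho_r D) < rs /\
  vs = u_l D - velocity_jump (gamma - 1) (rho_l D) rs /\
  velocity_jump (gamma - 1) (rho_l D) rs + velocity_jump (gamma - 1) (rho_r D) rs
    = u_l D - u_r D.
Proof.
  intros Hl Hr Hg. unfold intermediate_state.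
  assert (HMa := Rmax_l (rho_l D) (rho_r D)). assert (HMb := Rmax_r (rho_l D) (rho_r D)).
  assert (E : Rmax (rho_l D) (rho_r D) < rs ->
    shock_coef gamma rs (rho_l D) * (rs - rho_l D) = velocity_jump (gamma - 1) (rho_l D) rs /\
    shock_coef gamma (rho_r D) rs * (rho_r D - rs) = - velocity_jump (gamma - 1) (rho_r D) rs).
  { intros H. rewrite (shock_coef_sym gamma (rho_r D) rs) by lra.
    rewrite !shock_coef_velocity_jump by lra. split; field; lra. }
  split; intros (H1 & H2 & H3); destruct (E H1) as [E1 E2];
    (split; [exact H1|]); rewrite ?E1, ?E2 in *; lra.
Qed.

(** * Asymptotics of the intermediate state as [gamma] decreases to 1 *)

Lemma at_right_1_intro (e : R) (Q : R -> Prop) :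
  0 < e -> (forall gamma, 1 < gamma < 1 + e -> Q gamma) -> at_right 1 Q.
Proof.
  intros He H. exists (mkposreal e He). intros g Hg H1.
  change (Rabs (g - 1) < e) in Hg. apply Rabs_def2 in Hg. apply H. lra.
Qed.

Section SmallGamma.

Context (a b J : R) (r : R -> R) (Ha : 0 < a) (Hb : 0 < b) (HJ : 0 < J)
  (Hr : at_right 1 (fun gamma => a < r gamma /\ b < r gamma /\
    velocity_jump (gamma - 1) a (r gamma) + velocity_jump (gamma - 1) b (r gamma) = J)).

Lemma at_right_1_le_2 : at_right 1 (fun gamma => 1 < gamma <= 2).
Proof. apply (at_right_1_intro 1); intros; lra. Qed.

Lemma intermediate_density_unbounded (B : R) : at_right 1 (fun gamma => B < r gamma).
Proof.
  (* Two jumps of at most [sqrt y] add up to [J], so [(J/2)^2 <= y = d/2 (1 + r)]. For [d < e] this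
     is incompatible with [r <= B]. *)
  set (e := J ^ 2 / (2 * (1 + Rabs B))).
  assert (HB := Rabs_pos B). assert (HB' := Rle_abs B).
  assert (HJ2 : 0 < J ^ 2) by now apply pow_lt.
  assert (He : 0 < e) by (apply Rdiv_lt_0_compat; lra).
  assert (H1 : at_right 1 (fun gamma => 1 < gamma < 1 + e)) by now apply (at_right_1_intro e).
  generalize (filter_and _ _ at_right_1_le_2 (filter_and _ _ H1 Hr)).
  apply filter_imp. intros g (Hg2 & Hg & Hra & Hrb & E).
  assert (K1 := velocity_jump_le (g - 1) a (r g) ltac:(lra) ltac:(lra)).
  assert (K2 := velocity_jump_le (g - 1) b (r g) ltac:(lra) ltac:(lra)).
  set (y := (g - 1) / 2 * (1 + r g)) in *.
  assert (Hy : 0 <= y) by (apply Rmult_le_pos; lra).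
  assert (HJy : (J / 2) ^ 2 <= y).
  { rewrite <- (pow2_sqrt y Hy). apply pow_incr. lra. }
  apply Rnot_le_lt. intros HrB.
  assert (Hg' : (g - 1) * (2 * (1 + Rabs B)) < J ^ 2).
  { apply Rlt_div_r; [lra|]. unfold e in Hg. lra. }
  assert (y <= (g - 1) / 2 * (1 + Rabs B)) by (apply Rmult_le_compat_l; lra).
  lra.
Qed.

(** The divergence of the density enters the later limits through this quantity, for instance as
    [r / (r - c) = 1 + c / (r - c)], which keeps every limit finite. *)
Lemma inv_density_gap_limit (c : R) :
  filterlim (fun gamma => / (r gamma - c)) (at_right 1) (locally 0).
Proof.
  apply filterlim_locally. intros eps.
  generalize (intermediate_density_unbounded (c + / eps)). apply filter_imp.
  intros g Hg. change (Rabs (/ (r g - c) - 0) < eps). rewrite Rminus_0_r.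
  assert (He := cond_pos eps). assert (Hi := Rinv_0_lt_compat _ He).
  rewrite Rabs_pos_eq by (apply Rlt_le, Rinv_0_lt_compat; lra).
  rewrite <- (Rinv_inv eps). apply Rinv_lt_contravar; [|lra].
  apply Rmult_lt_0_compat; lra.
Qed.

Lemma gamma_minus_1_limit : filterlim (fun gamma => gamma - 1) (at_right 1) (locally 0).
Proof.
  apply filterlim_locally. intros eps. exists eps. intros g Hg _.
  change (Rabs (g - 1 - 0) < eps). now rewrite Rminus_0_r.
Qed.

(* Both [k^2 (1 + 2 c / (r - c)) + d/2 c^d], for [k = velocity_jump d c r] and
   [c = a, b], equal [d/2 r^d]; so the squares of the two jumps get close. *)
Lemma velocity_jump_limit :
  filterlim (fun gamma => velocity_jump (gamma - 1) a (r gamma)) (at_right 1)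
    (locally (J / 2)).
Proof.
  apply (filterlim_squeeze _ (fun gamma =>
    (J ^ 2 * (2 * a * / (r gamma - a) + 2 * b * / (r gamma - b))
     + (gamma - 1) * (1 + (a + b) / 2)) * / (2 * J))).
  - generalize (filter_and _ _ at_right_1_le_2 Hr). apply filter_imp.
    intros g (Hg & Hra & Hrb & E). set (d := g - 1) in *.
    set (ka := velocity_jump d a (r g)) in *. set (kb := velocity_jump d b (r g)) in *.
    assert (Pa : 0 <= ka) by apply velocity_jump_pos.
    assert (Pb : 0 <= kb) by apply velocity_jump_pos.
    assert (Sa : ka ^ 2 * (r g + a) = d / 2 * (Rpower (r g) d - Rpower a d) * (r g - a))
      by (apply velocity_jump_sqr; unfold d; lra).
    assert (Sb : kb ^ 2 * (r g + b) = d / 2 * (Rpower (r g) d - Rpower b d) * (r g - b))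
      by (apply velocity_jump_sqr; unfold d; lra).
    assert (Ga : ka ^ 2 + ka ^ 2 * (2 * a * / (r g - a)) + d / 2 * Rpower a d
      = d / 2 * Rpower (r g) d).
    { replace (ka ^ 2 + ka ^ 2 * (2 * a * / (r g - a)))
        with (ka ^ 2 * (r g + a) * / (r g - a)) by (field; lra).
      rewrite Sa. field. lra. }
    assert (Gb : kb ^ 2 + kb ^ 2 * (2 * b * / (r g - b)) + d / 2 * Rpower b d
      = d / 2 * Rpower (r g) d).
    { replace (kb ^ 2 + kb ^ 2 * (2 * b * / (r g - b)))
        with (kb ^ 2 * (r g + b) * / (r g - b)) by (field; lra).
      rewrite Sb. field. lra. }
    assert (Ia : 0 <= 2 * a * / (r g - a)).
    { apply Rmult_le_pos; [lra|]. apply Rlt_le, Rinv_0_lt_compat. lra. }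
    assert (Ib : 0 <= 2 * b * / (r g - b)).
    { apply Rmult_le_pos; [lra|]. apply Rlt_le, Rinv_0_lt_compat. lra. }
    set (ea := 2 * a * / (r g - a)) in *. set (eb := 2 * b * / (r g - b)) in *.
    assert (Ja : 0 <= ka ^ 2 * ea <= J ^ 2 * ea).
    { split; [apply Rmult_le_pos; [apply pow2_ge_0|exact Ia]|].
      apply Rmult_le_compat_r; [exact Ia|]. apply pow_incr. lra. }
    assert (Jb : 0 <= kb ^ 2 * eb <= J ^ 2 * eb).
    { split; [apply Rmult_le_pos; [apply pow2_ge_0|exact Ib]|].
      apply Rmult_le_compat_r; [exact Ib|]. apply pow_incr. lra. }
    assert (Na : 0 <= d / 2 * Rpower a d <= d / 2 * (1 + a)).
    { split; [apply Rmult_le_pos; [unfold d; lra|apply Rlt_le, exp_pos]|].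
      apply Rmult_le_compat_l; [unfold d; lra|]. apply Rpower_le_1_plus; unfold d; lra. }
    assert (Nb : 0 <= d / 2 * Rpower b d <= d / 2 * (1 + b)).
    { split; [apply Rmult_le_pos; [unfold d; lra|apply Rlt_le, exp_pos]|].
      apply Rmult_le_compat_l; [unfold d; lra|]. apply Rpower_le_1_plus; unfold d; lra. }
    (* Since [ka + kb = J], the difference [ka - J/2] is [(ka - kb) / 2], and closeness of the
       squares gives closeness of the jumps. *)
    replace (ka - J / 2) with ((ka ^ 2 - kb ^ 2) * / (2 * J))
      by (rewrite <- E; field; lra).
    rewrite Rabs_mult, (Rabs_pos_eq (/ (2 * J)))
      by (apply Rlt_le, Rinv_0_lt_compat; lra).
    apply Rmult_le_compat_r; [apply Rlt_le, Rinv_0_lt_compat; lra|].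
    apply Rabs_le. lra.
  - eapply filterlim_eq; [apply filter_forall; intros; reflexivity| |].
    2:{ repeat first [apply inv_density_gap_limit | apply gamma_minus_1_limit
          | apply filterlim_Rmult | apply filterlim_Rplus
          | apply filterlim_Rconst]. }
    ring.
Qed.

End SmallGamma.

(** * Two-shock and delta shock solutions *)

Lemma three_states_mult (a b l m r l' m' r' x : R) :
  three_states a b l m r x * three_states a b l' m' r' x =
  three_states a b (l * l') (m * m') (r * r') x.
Proof.
  unfold three_states.
  destruct (Rlt_dec x a); [|destruct (Rlt_dec b x)]; reflexivity.
Qed.

Lemma RInt_accelerated (beta s t : R) (speed : R -> R) :
  (forall u, speed u = s + beta * u) -> RInt speed 0 t = accelerated beta s t.
Proof.
  intros H. apply is_RInt_unique.
  apply (is_RInt_ext (fun u => s + beta * u)); [intros; now rewrite H|].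
  replace (accelerated beta s t) with (minus (accelerated beta s t) (accelerated beta s 0)).
  - apply (is_RInt_derive (accelerated beta s)).
    + intros. apply accelerated_is_derive.
    + intros. apply continuous_Rplus; [apply continuous_const|].
      apply continuous_Rmult; [apply continuous_const|apply continuous_id].
  - unfold minus, plus, opp, accelerated; simpl. ring.
Qed.

Definition initial_speed1 (D : riemann_data) (gamma rs : R) : R :=
  u_l D - rs * shock_coef gamma rs (rho_l D).

Definition initial_speed2 (D : riemann_data) (gamma rs vs : R) : R :=
  vs + rho_r D * shock_coef gamma (rho_r D) rs.

Lemma shock_speed1_affine D beta gamma rs t :
  shock_speed1 D beta gamma rs t = initial_speed1 D gamma rs + beta * t.
Proof. unfold shock_speed1, initial_speed1. ring. Qed.

Lemma shock_speed2_affine D beta gamma rs vs t :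
  shock_speed2 D beta gamma rs vs t = initial_speed2 D gamma rs vs + beta * t.
Proof. unfold shock_speed2, initial_speed2. ring. Qed.

Lemma shock_pos1_accelerated D beta gamma rs t :
  shock_pos1 D beta gamma rs t = accelerated beta (initial_speed1 D gamma rs) t.
Proof. apply RInt_accelerated. intros. apply shock_speed1_affine. Qed.

Lemma shock_pos2_accelerated D beta gamma rs vs t :
  shock_pos2 D beta gamma rs vs t = accelerated beta (initial_speed2 D gamma rs vs) t.
Proof. apply RInt_accelerated. intros. apply shock_speed2_affine. Qed.

(** The definition of the shock coefficient solved for the pressure. It makes the Rankine-Hugoniot
    condition of the velocity equation a polynomial identity, without roots or powers. *)
Lemma shock_coef_sqr (gamma a r : R) :
  1 < gamma -> 0 < a < r ->
  (gamma - 1) / 4 * Rpower r (gamma - 1) =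
  (gamma - 1) / 4 * Rpower a (gamma - 1) + shock_coef gamma r a ^ 2 * (r + a) * (r - a) / 2.
Proof.
  intros Hg H. rewrite shock_coef_velocity_jump by lra.
  assert (E := velocity_jump_sqr (gamma - 1) a r ltac:(lra) ltac:(lra)).
  replace ((velocity_jump (gamma - 1) a r / (r - a)) ^ 2 * (r + a) * (r - a) / 2)
    with (velocity_jump (gamma - 1) a r ^ 2 * (r + a) / (2 * (r - a))) by (field; lra).
  rewrite E. field. lra.
Qed.

(** As a sum of nonnegative terms the gap orders the shocks; multiplied by [rs] it is the rate of
    growth of the mass between them. *)
Lemma initial_speed_gap D gamma rs vs :
  intermediate_state D gamma rs vs ->
  initial_speed2 D gamma rs vs - initial_speed1 D gamma rs =
    rho_l D * shock_coef gamma rs (rho_l D) + rho_r D * shock_coef gamma (rho_r D) rs.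
Proof. intros (_ & E & _). unfold initial_speed1, initial_speed2. rewrite E. ring. Qed.

Lemma initial_speed_le D gamma rs vs :
  0 < rho_l D -> 0 < rho_r D -> intermediate_state D gamma rs vs ->
  initial_speed1 D gamma rs <= initial_speed2 D gamma rs vs.
Proof.
  intros Hl Hr H. apply Rminus_le_0. rewrite (initial_speed_gap _ _ _ _ H).
  apply Rplus_le_le_0_compat; apply Rmult_le_pos; try apply sqrt_pos; lra.
Qed.

Lemma accelerated_0 beta s : accelerated beta s 0 = 0.
Proof. unfold accelerated. ring. Qed.

Lemma accelerated_le beta s s' t :
  s <= s' -> 0 <= t -> accelerated beta s t <= accelerated beta s' t.
Proof.
  intros Hs Ht. apply Rplus_le_compat_r. now apply Rmult_le_compat_r.
Qed.

Lemma affine_continuous (c d t : R) : continuous (fun u => c + d * u) t.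
Proof.
  apply continuous_Rplus; [apply continuous_const|].
  apply continuous_Rmult; [apply continuous_const|apply continuous_id].
Qed.

Lemma affine_is_derive (c d t : R) : is_derive (fun u => c + d * u) t d.
Proof. auto_derive; [trivial|ring]. Qed.

Lemma const_is_derive (c t : R) : is_derive (fun _ => c) t 0.
Proof. apply is_derive_Reals, derivable_pt_lim_const. Qed.

Lemma two_shock_weak_solution D beta gamma rs vs :
  0 < rho_l D -> 0 < rho_r D -> 1 < gamma -> intermediate_state D gamma rs vs ->
  euler_weak_solution D beta gamma
    (two_shock_rho D beta gamma rs vs) (two_shock_u D beta gamma rs vs).
Proof.
  intros Hl Hr Hg H. assert (Hle := initial_speed_le _ _ _ _ Hl Hr H).
  set (s1 := initial_speed1 D gamma rs) in *.
  set (s2 := initial_speed2 D gamma rs vs) in *.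
  assert (Hord : forall t, 0 <= t -> accelerated beta s1 t <= accelerated beta s2 t)
    by (intros; now apply accelerated_le).
  destruct H as (Hrs & Hvs & Hur).
  assert (HMa := Rmax_l (rho_l D) (rho_r D)). assert (HMb := Rmax_r (rho_l D) (rho_r D)).
  assert (P1 := shock_coef_sqr gamma (rho_l D) rs Hg ltac:(lra)).
  assert (P2 := shock_coef_sqr gamma (rho_r D) rs Hg ltac:(lra)).
  rewrite (shock_coef_sym gamma rs (rho_r D)) in P2 by lra.
  unfold initial_speed1 in s1. unfold initial_speed2 in s2.
  set (c1 := shock_coef gamma rs (rho_l D)) in *.
  set (c2 := shock_coef gamma (rho_r D) rs) in *.
  split.
  - apply (weak_balance_three_states
      (accelerated beta s1) (fun t => s1 + beta * t)
      (accelerated beta s2) (fun t => s2 + beta * t)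
      (fun _ => rho_l D) (fun _ => rs) (fun _ => rho_r D)
      (fun t => rho_l D * (u_l D + beta * t)) (fun t => rs * (vs + beta * t))
      (fun t => rho_r D * (u_r D + beta * t)));
      try (intros; apply accelerated_is_derive); try (intros; apply affine_continuous);
      try (intros; apply const_is_derive); try apply accelerated_0; try exact Hord.
    + intros t. unfold s1. rewrite Hvs. ring.
    + intros t. unfold s2. rewrite Hur. ring.
    + intros t x _ _. unfold two_shock_rho.
      now rewrite shock_pos1_accelerated, shock_pos2_accelerated.
    + intros t x _ _. unfold two_shock_rho, two_shock_u.
      now rewrite three_states_mult, shock_pos1_accelerated, shock_pos2_accelerated.
  (* The general balance lemma takes its initial data from the outer states at time 0, here
     [u + beta * 0]. *)
  - replace (riemann_step (u_l D) (u_r D)) with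
      (riemann_step (u_l D + beta * 0) (u_r D + beta * 0))
      by (rewrite Rmult_0_r, !Rplus_0_r; reflexivity).
    apply (weak_balance_three_states
      (accelerated beta s1) (fun t => s1 + beta * t)
      (accelerated beta s2) (fun t => s2 + beta * t)
      (fun t => u_l D + beta * t) (fun t => vs + beta * t) (fun t => u_r D + beta * t)
      (fun t => (u_l D + beta * t) ^ 2 / 2 + (gamma - 1) / 4 * Rpower (rho_l D) (gamma - 1))
      (fun t => (vs + beta * t) ^ 2 / 2 + (gamma - 1) / 4 * Rpower rs (gamma - 1))
      (fun t => (u_r D + beta * t) ^ 2 / 2 + (gamma - 1) / 4 * Rpower (rho_r D) (gamma - 1)));
      try (intros; apply accelerated_is_derive); try (intros; apply affine_continuous);
      try (intros; apply affine_is_derive); try apply accelerated_0; try exact Hord.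
    + intros t. rewrite P1. unfold s1. rewrite Hvs. field.
    + intros t. rewrite P2. unfold s2. rewrite Hur. field.
    + intros t x _ _. unfold two_shock_u.
      now rewrite shock_pos1_accelerated, shock_pos2_accelerated.
    + intros t x _ _. unfold two_shock_rho, two_shock_u, three_states.
      rewrite shock_pos1_accelerated, shock_pos2_accelerated.
      fold s1 s2. unfold initial_speed1, initial_speed2. fold c1 c2. fold s1 s2.
      destruct (Rlt_dec x _); [|destruct (Rlt_dec _ x)]; reflexivity.
Qed.

Lemma delta_shock_is_solution D beta :
  u_r D < u_l D ->
  delta_shock_solution D beta (delta_pos D beta) (delta_weight D) (delta_speed D beta).
Proof.
  intros Hu.
  assert (HX : forall t, is_derive (delta_pos D beta) t (delta_speed D beta t))
    by (intros; apply accelerated_is_derive).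
  assert (Hw : forall t, is_derive (delta_weight D) t
    (delta_speed D beta t * (rho_r D - rho_l D)
     - (rho_r D * (u_r D + beta * t) - rho_l D * (u_l D + beta * t)))).
  { intros t. unfold delta_weight, delta_speed. auto_derive; [trivial|field]. }
  assert (HX0 : delta_pos D beta 0 = 0) by apply accelerated_0.
  assert (Hw0 : delta_weight D 0 = 0) by (unfold delta_weight; ring).
  assert (Cs : forall t, continuous (delta_speed D beta) t)
    by (intros; apply affine_continuous).
  split; [exact HX0|]. split; [exact Hw0|]. split; [|split].
  - intros t _. split; [apply HX|]. split; [apply Hw|].
    unfold delta_speed. split; [field|lra].
  - apply (weak_balance_delta_three_states
      (delta_pos D beta) (delta_speed D beta) (delta_pos D beta) (delta_speed D beta)
      (fun _ => rho_l D) (fun _ => rho_r D) (fun _ => rho_r D)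
      (fun t => rho_l D * (u_l D + beta * t)) (fun t => rho_r D * (u_r D + beta * t))
      (fun t => rho_r D * (u_r D + beta * t)) (delta_weight D)
      (fun t => delta_speed D beta t * (rho_r D - rho_l D)
        - (rho_r D * (u_r D + beta * t) - rho_l D * (u_l D + beta * t))));
      trivial; try (intros; apply const_is_derive); try (intros; apply Rle_refl).
    + intros t. apply continuous_Rminus; [|apply continuous_Rminus];
        (apply continuous_Rmult; auto using continuous_const, affine_continuous).
    + intros t. ring.
    (* On the curve the density is set to 0, which differs from the middle state [rho_r D]; [H]
       excludes that point. *)
    + intros t x H _. unfold delta_rho, three_states.
      destruct (Rlt_dec x _); [|destruct (Rlt_dec _ x)]; trivial. lra.
    + intros t x H _. unfold delta_rho, delta_u. rewrite three_states_mult.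
      unfold three_states.
      destruct (Rlt_dec x _); [|destruct (Rlt_dec _ x)]; trivial. lra.
  - replace (riemann_step (u_l D) (u_r D)) with
      (riemann_step (u_l D + beta * 0) (u_r D + beta * 0))
      by (rewrite Rmult_0_r, !Rplus_0_r; reflexivity).
    apply (weak_balance_three_states
      (delta_pos D beta) (delta_speed D beta) (delta_pos D beta) (delta_speed D beta)
      (fun t => u_l D + beta * t) (fun t => u_r D + beta * t) (fun t => u_r D + beta * t)
      (fun t => (u_l D + beta * t) ^ 2 / 2) (fun t => (u_r D + beta * t) ^ 2 / 2)
      (fun t => (u_r D + beta * t) ^ 2 / 2));
      trivial; try (intros; apply affine_is_derive); try (intros; apply Rle_refl).
    + intros t. unfold delta_speed. field.
    + intros t x H _. unfold delta_u, three_states.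
      destruct (Rlt_dec x _); [|destruct (Rlt_dec _ x)]; trivial. lra.
    + intros t x H _. unfold delta_u, three_states.
      destruct (Rlt_dec x _); [|destruct (Rlt_dec _ x)]; trivial. lra.
Qed.

(** * Formation of the delta shock in the limit *)

Lemma two_shock_converges D beta gamma0 (rs vs : R -> R) :
  0 < rho_l D -> 0 < rho_r D -> u_r D < u_l D -> 1 < gamma0 ->
  (forall gamma, 1 < gamma < gamma0 ->
    intermediate_state D gamma (rs gamma) (vs gamma)) ->
  converges_to_delta_shock D beta rs vs
    (delta_pos D beta) (delta_weight D) (delta_speed D beta).
Proof.
  intros Hl Hr Hu Hg0 Hst.
  set (J := u_l D - u_r D). set (sigma := / 2 * (u_l D + u_r D)).
  set (W := (rho_l D + rho_r D) * (J / 2)).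
  assert (HJ : 0 < J) by (unfold J; lra).
  assert (Ev : at_right 1 (fun g => 1 < g /\ intermediate_state D g (rs g) (vs g))).
  { apply (at_right_1_intro (gamma0 - 1)); [lra|]. intros g Hg.
    split; [lra|apply Hst; lra]. }
  assert (HMa := Rmax_l (rho_l D) (rho_r D)). assert (HMb := Rmax_r (rho_l D) (rho_r D)).
  set (kl g := velocity_jump (g - 1) (rho_l D) (rs g)).
  set (kr g := velocity_jump (g - 1) (rho_r D) (rs g)).
  assert (Ek : at_right 1 (fun g => rho_l D < rs g /\ rho_r D < rs g /\
    kl g + kr g = J /\ vs g = u_l D - kl g /\
    shock_coef g (rs g) (rho_l D) = kl g * / (rs g - rho_l D) /\
    shock_coef g (rho_r D) (rs g) = kr g * / (rs g - rho_r D) /\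
    initial_speed2 D g (rs g) (vs g) - initial_speed1 D g (rs g) =
      rho_l D * shock_coef g (rs g) (rho_l D) + rho_r D * shock_coef g (rho_r D) (rs g))).
  { revert Ev. apply filter_imp. intros g [Hg H].
    assert (Hgap := initial_speed_gap _ _ _ _ H).
    apply intermediate_state_velocity_jump in H; [|lra..]. destruct H as (H1 & H2 & H3).
    rewrite (shock_coef_sym g (rho_r D) (rs g)) in * by lra.
    rewrite !shock_coef_velocity_jump in * by lra.
    unfold kl, kr, J. repeat split; trivial; lra. }
  assert (Il := inv_density_gap_limit (rho_l D) (rho_r D) J rs Hl Hr HJ).
  assert (Lkl : filterlim kl (at_right 1) (locally (J / 2))).
  { apply (velocity_jump_limit (rho_l D) (rho_r D)); trivial.
    revert Ek. apply filter_imp. intros g (H1 & H2 & H3 & _). repeat split; trivial. }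
  assert (Lkr : filterlim kr (at_right 1) (locally (J / 2))).
  { apply (velocity_jump_limit (rho_r D) (rho_l D)); trivial.
    revert Ek. apply filter_imp. intros g (H1 & H2 & H3 & _). repeat split; trivial.
    rewrite Rplus_comm. exact H3. }
  assert (Linv : forall c, filterlim (fun g => / (rs g - c)) (at_right 1) (locally 0)).
  { intros c. apply Il.
    revert Ek. apply filter_imp. intros g (H1 & H2 & H3 & _). repeat split; trivial. }
  clear Il.
  assert (Lvs : filterlim vs (at_right 1) (locally sigma)).
  { apply (filterlim_eq (fun g => u_l D - kl g) vs (u_l D - J / 2)).
    - revert Ek. apply filter_imp. intros g H. symmetry. apply H.
    - unfold sigma, J. field.
    - apply filterlim_Rminus; [apply filterlim_Rconst|exact Lkl]. }
  assert (Lrc1 : filterlim (fun g => rs g * shock_coef g (rs g) (rho_l D)) (at_right 1)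
    (locally (J / 2))).
  { apply (filterlim_eq (fun g => kl g * (1 + rho_l D * / (rs g - rho_l D))) _
      (J / 2 * (1 + rho_l D * 0))).
    - revert Ek. apply filter_imp. intros g (H1 & _ & _ & _ & E & _ & _). rewrite E.
      field. lra.
    - ring.
    - apply filterlim_Rmult; [apply Lkl|].
      apply filterlim_Rplus; [apply filterlim_Rconst|].
      apply filterlim_Rmult; [apply filterlim_Rconst|apply Linv]. }
  assert (Lrc2 : filterlim (fun g => rs g * shock_coef g (rho_r D) (rs g)) (at_right 1)
    (locally (J / 2))).
  { apply (filterlim_eq (fun g => kr g * (1 + rho_r D * / (rs g - rho_r D))) _
      (J / 2 * (1 + rho_r D * 0))).
    - revert Ek. apply filter_imp. intros g (_ & H2 & _ & _ & _ & E & _). rewrite E.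
      field. lra.
    - ring.
    - apply filterlim_Rmult; [apply Lkr|].
      apply filterlim_Rplus; [apply filterlim_Rconst|].
      apply filterlim_Rmult; [apply filterlim_Rconst|apply Linv]. }
  assert (Lc2 : filterlim (fun g => shock_coef g (rho_r D) (rs g)) (at_right 1) (locally 0)).
  { apply (filterlim_eq (fun g => kr g * / (rs g - rho_r D)) _ (J / 2 * 0)).
    - revert Ek. apply filter_imp. intros g H. symmetry. apply H.
    - ring.
    - apply filterlim_Rmult; [apply Lkr|apply Linv]. }
  set (s1 g := initial_speed1 D g (rs g)). set (s2 g := initial_speed2 D g (rs g) (vs g)).
  assert (Ls1 : filterlim s1 (at_right 1) (locally sigma)).
  { replace sigma with (u_l D - J / 2) by (unfold sigma, J; field).
    apply filterlim_Rminus; [apply filterlim_Rconst|exact Lrc1]. }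
  assert (Ls2 : filterlim s2 (at_right 1) (locally sigma)).
  { replace sigma with (sigma + rho_r D * 0) by ring.
    apply filterlim_Rplus; [exact Lvs|].
    apply filterlim_Rmult; [apply filterlim_Rconst|exact Lc2]. }
  assert (Lgap : filterlim (fun g => s2 g - s1 g) (at_right 1) (locally 0)).
  { replace 0 with (sigma - sigma) by ring. now apply filterlim_Rminus. }
  (* A middle value with a finite limit carries no mass in the limit; this is why [u] has no
     singular part. *)
  assert (L0 : forall (c : R -> R) (l : R), filterlim c (at_right 1) (locally l) ->
    filterlim (fun g => c g * (s2 g - s1 g)) (at_right 1) (locally 0)).
  { intros c l Hc. rewrite <- (Rmult_0_r l). now apply filterlim_Rmult. }
  assert (LW : filterlim (fun g => rs g * (s2 g - s1 g)) (at_right 1) (locally W)).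
  { apply (filterlim_eq (fun g => rho_l D * (rs g * shock_coef g (rs g) (rho_l D)) +
      rho_r D * (rs g * shock_coef g (rho_r D) (rs g))) _
      (rho_l D * (J / 2) + rho_r D * (J / 2))).
    - revert Ek. apply filter_imp. intros g H. unfold s1, s2.
      destruct H as (_ & _ & _ & _ & _ & _ & ->). ring.
    - unfold W. ring.
    - apply filterlim_Rplus; apply filterlim_Rmult; trivial; apply filterlim_Rconst. }
  assert (Hs : at_right 1 (fun g => s1 g <= s2 g)).
  { revert Ev. apply filter_imp. intros g [_ H]. now apply initial_speed_le. }
  assert (Cd : forall t, continuous (delta_speed D beta) t)
    by (intros; apply affine_continuous).
  repeat split.
  - apply (converges_three_states beta sigma W 0 (fun _ => rho_l D) (fun _ => 0)
      (fun _ => rho_r D) _ _ s1 s2 rs (fun _ => 0)); trivial;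
      try (intros; apply continuous_const).
    + intros t. unfold delta_weight, W, J. field.
    + apply filter_forall. intros g t x. unfold two_shock_rho.
      rewrite shock_pos1_accelerated, shock_pos2_accelerated, Rmult_0_l, Rplus_0_r.
      reflexivity.
    + apply (L0 (fun _ => 0) 0), filterlim_Rconst.
  - apply (converges_three_states beta sigma 0 0 (fun t => u_l D + beta * t)
      (delta_speed D beta) (fun t => u_r D + beta * t) _ _ s1 s2 vs (fun _ => beta)); trivial;
      try (intros; apply affine_continuous).
    + intros t. ring.
    + apply filter_forall. intros g t x. unfold two_shock_u.
      now rewrite shock_pos1_accelerated, shock_pos2_accelerated.
    + apply (L0 vs sigma Lvs).
    + apply (L0 (fun _ => beta) beta), filterlim_Rconst.
  (* The middle momentum [rs (vs + beta t)] is affine in [t]. Its mass tends to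
     [W (sigma + beta t) t], which is the weight times the delta shock speed. *)
  - apply (converges_three_states beta sigma (W * sigma) (W * beta)
      (fun t => rho_l D * (u_l D + beta * t)) (fun t => 0 * delta_speed D beta t)
      (fun t => rho_r D * (u_r D + beta * t)) _ _ s1 s2
      (fun g => rs g * vs g) (fun g => rs g * beta)); trivial;
      try (intros; apply continuous_Rmult; [apply continuous_const|apply affine_continuous]).
    + intros t. unfold delta_weight, delta_speed, W, J, sigma. field.
    + intros t x. apply three_states_mult.
    + apply filter_forall. intros g t x. unfold two_shock_rho, two_shock_u.
      rewrite three_states_mult, shock_pos1_accelerated, shock_pos2_accelerated.
      f_equal. ring.
    + apply (filterlim_ext (fun g => rs g * (s2 g - s1 g) * vs g)); [intros; ring|].
      now apply filterlim_Rmult.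
    + apply (filterlim_ext (fun g => rs g * (s2 g - s1 g) * beta)); [intros; ring|].
      apply filterlim_Rmult; [exact LW|apply filterlim_Rconst].
  - apply filterlim_Rplus; [exact Lvs|apply filterlim_Rconst].
  - apply (filterlim_ext (fun g => s1 g + beta * t)).
    { intros g. symmetry. apply shock_speed1_affine. }
    apply filterlim_Rplus; [exact Ls1|apply filterlim_Rconst].
  - apply (filterlim_ext (fun g => s2 g + beta * t)).
    { intros g. symmetry. apply shock_speed2_affine. }
    apply filterlim_Rplus; [exact Ls2|apply filterlim_Rconst].
Qed.

Theorem theorem4p4 (beta : R) (D : riemann_data)
    (Hrho_l : 0 < rho_l D) (Hrho_r : 0 < rho_r D) (Hu : u_r D < u_l D) :
  exists gamma0 : R, 1 < gamma0 <= 2 /\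
    (forall gamma, 1 < gamma < gamma0 ->
      (exists! s : R * R, intermediate_state D gamma (fst s) (snd s)) /\
      (forall rs vs, intermediate_state D gamma rs vs ->
        euler_weak_solution D beta gamma
          (two_shock_rho D beta gamma rs vs)
          (two_shock_u D beta gamma rs vs))) /\
    (forall rs vs : R -> R,
      (forall gamma, 1 < gamma < gamma0 ->
        intermediate_state D gamma (rs gamma) (vs gamma)) ->
      converges_to_delta_shock D beta rs vs
        (delta_pos D beta) (delta_weight D) (delta_speed D beta)) /\
    delta_shock_solution D beta
      (delta_pos D beta) (delta_weight D) (delta_speed D beta).
Proof.
  set (J := u_l D - u_r D). set (M := Rmax (rho_l D) (rho_r D)).
  assert (HM : rho_l D <= M) by apply Rmax_l.
  (* The bound 1 keeps [gamma <= 2]; the other one is the smallness condition under which an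
     intermediate density exists. *)
  set (e := Rmin 1 (J ^ 2 / (2 * (1 + M)))).
  assert (HJ : 0 < J) by (unfold J; lra).
  assert (He : 0 < e).
  { apply Rmin_pos; [lra|]. apply Rdiv_lt_0_compat; [now apply pow_lt|lra]. }
  assert (He1 : e <= 1) by apply Rmin_l.
  assert (He2 : e <= J ^ 2 / (2 * (1 + M))) by apply Rmin_r.
  exists (1 + e). split; [lra|]. split; [|split].
  - intros g Hg. split.
    + destruct (intermediate_density_exists (g - 1) (rho_l D) (rho_r D) J) as (r & Hr & E);
        [lra..| |].
      { apply Rlt_div_r; [unfold M in HM; lra|]. unfold M in He2. lra. }
      exists (r, u_l D - velocity_jump (g - 1) (rho_l D) r). split.
      * apply intermediate_state_velocity_jump; [lra..|]. now repeat split.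
      * intros [r' v'] H. apply intermediate_state_velocity_jump in H; [|lra..].
        simpl in H. destruct H as (Hr' & -> & E').
        rewrite (intermediate_density_unique (g - 1) (rho_l D) (rho_r D) r r'); trivial; [lra|].
        now rewrite E, E'.
    + intros rs vs H. apply two_shock_weak_solution; trivial. lra.
  - intros rs vs H. apply (two_shock_converges D beta (1 + e)); trivial. lra.
  - now apply delta_shock_is_solution.
Qed.
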